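(* Let $G$ be a homogeneous Lie group with a homogeneous metric $d$, and let $\Lambda\subseteq G$ be a Delone set which is linearly repetitive with respect to $d$. Then the hull $\mathcal H_\Lambda$, with the action of $G$ by translations, is minimal and uniquely ergodic.
   Context: A homogeneous Lie group is a connected, simply connected Lie group $G$ whose Lie algebra $\mathfrak g$ is equipped with a family of dilations, i.e. Lie algebra automorphisms $D_\lambda=\exp(A\log\lambda)$ ($\lambda>0$), where $A$ is a diagonalizable linear map on $\mathfrak g$ with positive real eigenvalues; such a $G$ is nilpotent, and the $D_\lambda$ integrate to automorphisms of $G$, also denoted $D_\lambda$. A homogeneous metric on $G$ is a left-invariant metric $d$ which induces the topology of $G$ and satisfies $d(D_\lambda g,D_\lambda h)=\lambda\, d(g,h)$ for all $g,h\in G$, $\lambda>0$. Write $B_t(g)=\{h\in G: d(h,g)<t\}$. A subset $\Lambda\subseteq G$ is a Delone set if there exist $R>r>0$ such that $d(x,y)\ge r$ for all distinct $x,y\in\Lambda$ and every $x\in G$ is at distance at most $R$ from $\Lambda$. It is linearly repetitive with respect to $d$ if there is a constant $c_\Lambda\ge 1$ such that every pattern of $\Lambda$ of radius $\rho\ge1$ occurs in every ball of radius $c_\Lambda\rho$; that is, for all $\rho\ge 1$ and all $x,h\in G$ there is $g\in G$ with $gB_\rho(x)\subseteq B_{c_\Lambda\rho}(h)$ and $g(\Lambda\cap B_\rho(x))=\Lambda\cap gB_\rho(x)$. The hull $\mathcal H_\Lambda$ is the closure of $\{g\Lambda: g\in G\}$ in the space of closed subsets of $G$ with respect to the Chabauty--Fell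 topology; $G$ acts on it continuously by left translation. Minimal means that every orbit is dense in $\mathcal H_\Lambda$; uniquely ergodic means that there is exactly one $G$-invariant Borel probability measure on $\mathcal H_\Lambda$. *)

(* Defs.v *)
From HB Require Import structures.
From mathcomp Require Import all_boot all_order all_algebra.
From mathcomp Require Import finmap.
From mathcomp Require Import all_classical all_reals all_analysis.

Set Implicit Arguments.
Unset Strict Implicit.
Unset Printing Implicit Defensive.

Import Order.TTheory GRing.Theory Num.Theory.
Import numFieldNormedType.Exports.

Local Open Scope classical_set_scope.
Local Open Scope ring_scope.

HB.mixin Record isTopologicalGroup (G : Type) of Topological G & Group G := {
  mulg_continuous : continuous (fun xy : G * G => (xy.1 * xy.2)%g) ;
  invg_continuous : continuous (fun x : G => x^-1%g) }.

#[short(type="topologicalGroupType")]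
HB.structure Definition TopologicalGroup :=
  {G of Topological G & Group G & isTopologicalGroup G}.

Definition ltrans (G : groupType) (g : G) (A : set G) : set G :=
  (fun x => (g * x)%g) @` A.

Fixpoint Ck_on (R : realType) (V W : normedModType R) (k : nat) (U : set V)
    (f : V -> W) : Prop :=
  (forall x, U x -> {for x, continuous f}) /\
  (if k is k'.+1 then
     forall v : V, (forall x, U x -> derivable f x v) /\
                   Ck_on k' U (fun x => 'D_v f x)
   else True).

Definition smooth_on (R : realType) (V W : normedModType R) (U : set V)
    (f : V -> W) : Prop := forall k, Ck_on k U f.

(* [param] is the inverse of [coord]; their values off [dom] and
   [coord @` dom] are irrelevant. *)
Record chart (R : realType) (n : nat) (T : topologicalType) := Chart {
  dom : set T ;
  coord : T -> 'rV[R]_n ;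
  param : 'rV[R]_n -> T ;
  dom_open : open dom ;
  coord_open : open (coord @` dom) ;
  coordK : {in dom, cancel coord param} ;
  coord_continuous : {within dom, continuous coord} ;
  param_continuous : {within coord @` dom, continuous param} }.

HB.mixin Record isLieGroup (R : realType) (n : nat) (G : Type)
    of TopologicalGroup G := {
  lie_hausdorff : hausdorff_space G ;
  lie_second_countable : @second_countable G ;
  atlas : set (chart R n G) ;
  atlas_cover : forall x : G, exists2 c, atlas c & dom c x ;
  atlas_smooth : forall a b, atlas a -> atlas b ->
    smooth_on (coord a @` (dom a `&` dom b)) (coord b \o param a) ;
  mulg_smooth : forall a b c, atlas a -> atlas b -> atlas c ->
    smooth_on
      [set xy : 'rV[R]_n * 'rV[R]_n |
        [/\ (coord a @` dom a) xy.1, (coord b @` dom b) xy.2 &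
            dom c (param a xy.1 * param b xy.2)%g]]
      (fun xy => coord c (param a xy.1 * param b xy.2)%g) ;
  invg_smooth : forall a b, atlas a -> atlas b ->
    smooth_on
      [set x | (coord a @` dom a) x /\ dom b (param a x)^-1%g]
      (fun x => coord b (param a x)^-1%g) }.

#[short(type="lieGroupType")]
HB.structure Definition LieGroup (R : realType) (n : nat) :=
  {G of TopologicalGroup G & isLieGroup R n G}.

Definition simply_connected (R : realType) (T : topologicalType) : Prop :=
  (forall x y : T, exists f : R -> T,
    [/\ {within `[0, 1], continuous f}, f 0 = x & f 1 = y]) /\
  (forall f : R -> T, {within `[0, 1], continuous f} -> f 0 = f 1 ->
    exists H : R * R -> T,
      [/\ {within `[0, 1] `*` `[0, 1], continuous H},
          forall t, t \in `[0, 1] -> H (0, t) = f t /\ H (1, t) = f 0 &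
          forall s, s \in `[0, 1] -> H (s, 0) = f 0 /\ H (s, 1) = f 0]).

Section LieAlgebra.
Context {R : realType} {n : nat} (G : lieGroupType R n).

Definition smooth_fun (f : G -> R) : Prop :=
  forall a : chart R n G, atlas a ->
    smooth_on (coord a @` dom a) (f \o param a).

Definition smooth_map (phi : G -> G) : Prop :=
  continuous phi /\
  forall a b : chart R n G, atlas a -> atlas b ->
    smooth_on (coord a @` (dom a `&` phi @^-1` dom b))
      (coord b \o phi \o param a).

Definition lie_group_automorphism (phi : G -> G) : Prop :=
  {morph phi : x y / (x * y)%g} /\
  exists psi : G -> G,
    [/\ cancel phi psi, cancel psi phi, smooth_map phi & smooth_map psi].

(* Vector fields are derivations of the algebra of smooth functions; the value
   of [X f] for a non-smooth [f] is irrelevant. *)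
Record left_invariant_vector_field (X : (G -> R) -> G -> R) : Prop := {
  vf_smooth : forall f, smooth_fun f -> smooth_fun (X f) ;
  vf_linear : forall a f g, smooth_fun f -> smooth_fun g ->
    X (fun x => a * f x + g x) = (fun x => a * X f x + X g x) ;
  vf_leibniz : forall f g, smooth_fun f -> smooth_fun g ->
    X (fun x => f x * g x) = (fun x => X f x * g x + f x * X g x) ;
  vf_left_invariant : forall h f, smooth_fun f ->
    X (fun x => f (h * x)%g) = (fun x => X f (h * x)%g) }.

(* The Lie algebra of G: the space of left-invariant vector fields under the
   commutator, identified with 'rV_n by the choice of a basis. *)
Record lieAlgebra := LieAlgebra {
  lvf : 'rV[R]_n -> (G -> R) -> G -> R ;
  lvf_left_invariant : forall v, left_invariant_vector_field (lvf v) ;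
  lvf_linear : forall a u v f, smooth_fun f ->
    lvf (a *: u + v) f = (fun x => a * lvf u f x + lvf v f x) ;
  lvf_inj : forall u v, (forall f, smooth_fun f -> lvf u f = lvf v f) ->
    u = v ;
  lvf_surj : forall X, left_invariant_vector_field X ->
    exists v, forall f, smooth_fun f -> X f = lvf v f ;
  lie_bracket : 'rV[R]_n -> 'rV[R]_n -> 'rV[R]_n ;
  lie_bracketE : forall u v f, smooth_fun f ->
    lvf (lie_bracket u v) f =
      (fun x => lvf u (lvf v f) x - lvf v (lvf u f) x) }.

Definition expmx (M : 'M[R]_n) : 'M[R]_n :=
  lim (series (fun k => k`!%:R^-1 *: M ^+ k) @ \oo).

(* Linear maps act on row vectors by right multiplication. The last field says
   that the differential of [dilation l] is the Lie algebra dilation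
   [expmx (ln l *: dil_gen)]: it sends the vector field of v to its
   push-forward by [dilation l]. *)
Record homogeneousStructure := HomogeneousStructure {
  hlie : lieAlgebra ;
  dil_gen : 'M[R]_n ;
  dil_gen_diagonalizable : diagonalizable dil_gen ;
  dil_gen_gt0 : forall a, eigenvalue dil_gen a -> 0 < a ;
  dil_bracket : forall l u v, 0 < l ->
    lie_bracket hlie (u *m expmx (ln l *: dil_gen))
                     (v *m expmx (ln l *: dil_gen)) =
    lie_bracket hlie u v *m expmx (ln l *: dil_gen) ;
  dilation : R -> G -> G ;
  dilation_aut : forall l, 0 < l -> lie_group_automorphism (dilation l) ;
  dilation_diff : forall l v f, 0 < l -> smooth_fun f ->
    lvf hlie v (f \o dilation l) =
    lvf hlie (v *m expmx (ln l *: dil_gen)) f \o dilation l }.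

Record homogeneousMetric (D : homogeneousStructure) := HomogeneousMetric {
  hdist :> G -> G -> R ;
  hdist_eq0 : forall x y, hdist x y = 0 <-> x = y ;
  hdistC : forall x y, hdist x y = hdist y x ;
  hdist_triangle : forall x y z, hdist x z <= hdist x y + hdist y z ;
  hdist_left_invariant : forall g x y, hdist (g * x)%g (g * y)%g = hdist x y ;
  hdist_nbhs : forall (x : G) (U : set G), nbhs x U <->
    exists2 e : R, 0 < e & [set y | hdist y x < e] `<=` U ;
  hdist_dilation : forall l x y, 0 < l ->
    hdist (dilation D l x) (dilation D l y) = l * hdist x y }.

End LieAlgebra.

Section Delone.
Context {R : realType} {n : nat} {G : lieGroupType R n}
  {D : homogeneousStructure G} (d : homogeneousMetric D).

Definition hball (t : R) (g : G) : set G := [set h | d h g < t].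

Record deloneSet := DeloneSet {
  delone_carrier :> set G ;
  deloneP : exists r s : R,
    [/\ 0 < r, r < s,
        forall x y, delone_carrier x -> delone_carrier y -> x <> y ->
          r <= d x y &
        forall x, exists2 y, delone_carrier y & d x y <= s] }.

Definition linearly_repetitive (L : set G) : Prop :=
  exists2 c : R, 1 <= c &
    forall rho, 1 <= rho -> forall x h : G, exists g : G,
      ltrans g (hball rho x) `<=` hball (c * rho) h /\
      ltrans g (L `&` hball rho x) = L `&` ltrans g (hball rho x).

End Delone.

Section ClosedSets.
Context (T : topologicalType).

Record closedSet := ClosedSet { cset :> set T ; cset_closed : closed cset }.

Lemma closedSet_inj (A B : closedSet) : A = B :> set T -> A = B.
Proof.
by case: A B => [A cA] [B cB] /= AB; subst B; congr ClosedSet; apply: Prop_irrelevance.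
Qed.

HB.instance Definition _ := gen_eqMixin closedSet.
HB.instance Definition _ := gen_choiceMixin closedSet.

(* Subbase of the Chabauty-Fell topology: [(true, U)] encodes the closed sets
   hitting the open set U, [(false, K)] those missing the compact set K. *)
Definition fell_index : set (bool * set T) :=
  [set i | if i.1 then open i.2 else compact i.2].

Definition fell_subbase (i : bool * set T) : set closedSet :=
  if i.1 then [set C : closedSet | C `&` i.2 !=set0]
  else [set C : closedSet | C `&` i.2 = set0].

HB.instance Definition _ :=
  isSubBaseTopological.Build closedSet fell_index fell_subbase.

Lemma fell_subbase_open i : fell_index i -> open (fell_subbase i).
Proof.
move=> Di; exists [set fell_subbase i]; last by rewrite bigcup_set1.
move=> _ ->; exists [fset i]%fset.
  by move=> j /fset1P ->; rewrite inE.
rewrite predeqE => C; split => [|iC j /=]; first by apply; rewrite /= inE.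
by move=> /fset1P ->.
Qed.

Lemma fell_continuous (S : topologicalType) (F : S -> closedSet) :
  (forall i, fell_index i -> open (F @^-1` fell_subbase i)) -> continuous F.
Proof.
move=> hF; apply/continuousP => _ [I hI <-].
rewrite preimage_bigcup; apply: bigcup_open => _ /hI [s sD <-].
rewrite preimage_bigcap openE => x /= xs.
apply: filter_bigI => i si; apply: open_nbhs_nbhs; split; last exact: xs.
by apply: hF; have := sD _ si; rewrite inE.
Qed.

End ClosedSets.

Section Hull.
Context (G : topologicalGroupType).

Lemma ltransE (g : G) (A : set G) : ltrans g A = (fun x => (g^-1 * x)%g) @^-1` A.
Proof.
apply/seteqP; split => [_ [x Ax <-]|x Ax] /=; first by rewrite mulKg.
by exists (g^-1 * x)%g => //; rewrite mulVKg.
Qed.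

Lemma ltransI (g : G) (A B : set G) :
  ltrans g (A `&` B) = ltrans g A `&` ltrans g B.
Proof. by rewrite !ltransE. Qed.

Lemma ltransK (g : G) : cancel (ltrans g) (ltrans g^-1).
Proof.
by move=> A; rewrite !ltransE; apply/seteqP; split => x /=; rewrite mulVKg.
Qed.

Lemma ltransM (g h : G) (A : set G) : ltrans (g * h)%g A = ltrans g (ltrans h A).
Proof.
by rewrite !ltransE; apply/seteqP; split => x /=; rewrite invgM mulgA.
Qed.

Lemma mulg_left_continuous (g : G) : continuous (fun x : G => (g * x)%g).
Proof.
move=> x; apply: (@continuous_comp _ _ _ (pair g)
    (fun xy : G * G => (xy.1 * xy.2)%g) x).
  by apply: cvg_pair => //; exact: cvg_cst.
exact: mulg_continuous.
Qed.

Lemma ltrans_closed (g : G) (A : set G) : closed A -> closed (ltrans g A).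
Proof.
move=> cA; rewrite ltransE; apply: preimage_closed cA => x _.
exact: mulg_left_continuous.
Qed.

Definition translate (g : G) (C : closedSet G) : closedSet G :=
  ClosedSet (ltrans_closed (g := g) (@cset_closed _ C)).

Lemma translateM (g h : G) (C : closedSet G) :
  translate (g * h)%g C = translate g (translate h C).
Proof. by apply: closedSet_inj; rewrite /= ltransM. Qed.

Lemma translate_continuous (g : G) : continuous (translate g).
Proof.
apply: fell_continuous => -[b A] hA.
have -> : translate g @^-1` fell_subbase (b, A) =
          fell_subbase (b, ltrans g^-1 A).
  have key (C : closedSet G) :
      ltrans g^-1 (translate g C `&` A) = C `&` ltrans g^-1 A.
    by rewrite ltransI /= ltransK.
  case: b hA => _; apply/seteqP; split => C; rewrite /fell_subbase /= -key.
  - by move=> [x hx]; exists (g^-1 * x)%g; exists x.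
  - by move=> [_ [x hx _]]; exists x.
  - by move=> ->; rewrite /ltrans image_set0.
  - move=> h; rewrite -subset0 => x hx.
    by have : (set0 : set G) (g^-1 * x)%g; [rewrite -h; exists x|].
apply: fell_subbase_open; case: b hA; rewrite /fell_index /= => hA.
  rewrite ltransE; apply: open_comp hA => x _; exact: mulg_left_continuous.
apply: continuous_compact hA; apply: continuous_subspaceT.
exact: mulg_left_continuous.
Qed.

Definition hull (C : closedSet G) : set (closedSet G) :=
  closure (range (translate^~ C)).

Lemma hull_self (C : closedSet G) : hull C C.
Proof.
apply: subset_closure; exists 1%g => //.
apply: closedSet_inj; rewrite /= ltransE.
by apply/seteqP; split => x /=; rewrite invg1 mul1g.
Qed.

Lemma hull_translate (C : closedSet G) (g : G) (A : closedSet G) :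
  hull C A -> hull C (translate g A).
Proof.
move=> hA U /(@translate_continuous g A) /hA [_ [[h _ <-] /= Uh]].
by exists (translate (g * h)%g C); split; [exists (g * h)%g|rewrite translateM].
Qed.

Definition hullType (C : closedSet G) : Type := set_type (hull C).

HB.instance Definition _ (C : closedSet G) := Topological.on (hullType C).
HB.instance Definition _ (C : closedSet G) :=
  isPointed.Build (hullType C) (exist _ C (mem_set (@hull_self C))).

Definition hull_act {C : closedSet G} (g : G) (x : hullType C) : hullType C :=
  exist _ (translate g (\val x)) (mem_set (hull_translate (g := g) (set_valP x))).

Definition minimal (C : closedSet G) : Prop :=
  forall x : hullType C, dense (range (hull_act^~ x)).

Definition hullBorel (C : closedSet G) :=
  g_sigma_algebraType (@open (hullType C)).

Definition uniquely_ergodic (R : realType) (C : closedSet G) : Prop :=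
  let invariant (mu : probability (hullBorel C) R) :=
    forall (g : G) (E : set (hullBorel C)), measurable E ->
      mu (@hull_act C g @^-1` E) = mu E in
  exists mu : probability (hullBorel C) R, invariant mu /\
    forall nu : probability (hullBorel C) R, invariant nu ->
      forall E, measurable E -> nu E = mu E.

End Hull.

Section DeloneClosed.
Context {R : realType} {n : nat} {G : lieGroupType R n}
  {D : homogeneousStructure G} {d : homogeneousMetric D}.

Lemma hdist_ge0 (x y : G) : 0 <= d x y.
Proof.
have := hdist_triangle d x y x; rewrite (hdistC d y x).
by rewrite (hdist_eq0 d x x).2// -mulr2n pmulrn_lge0.
Qed.

Lemma delone_closed (L : deloneSet d) : closed (L : set G).
Proof.
have [r [_ [r0 _ Lr _]]] := deloneP L.
have approx (x : G) e : 0 < e -> closure L x ->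
    exists2 y, delone_carrier L y & d y x < e.
  move=> e0 /(_ [set y | d y x < e]) [|y [Ly yx]]; last by exists y.
  by apply/(hdist_nbhs d); exists e.
move=> x Lx; have [y Ly yx] := approx x (r / 2) (divr_gt0 r0 (ltr0Sn _ 1)) Lx.
have [yx0|yx0] := eqVneq (d y x) 0; first by rewrite -((hdist_eq0 d _ _).1 yx0).
have yx_gt0 : 0 < d y x by rewrite lt_def yx0 hdist_ge0.
have [z Lz zx] := approx x (d y x) yx_gt0 Lx.
have yz : y <> z by move=> yz; move: zx; rewrite -yz ltxx.
have := le_trans (Lr _ _ Ly Lz yz) (hdist_triangle d y x z).
rewrite (hdistC d x z) leNgt [X in _ < X]splitr ltrD//.
exact: lt_trans zx yx.
Qed.

Definition delone_closedSet (L : deloneSet d) : closedSet G :=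
  ClosedSet (@delone_closed L).

End DeloneClosed.

(* Main.v *)
Require Import Defs.
From HB Require Import structures.
From mathcomp Require Import all_boot all_order all_algebra.
From mathcomp Require Import all_classical all_reals all_analysis.
From mathcomp Require Import measurable_realfun borel_hierarchy.
From mathcomp Require Import ring lra.

Set Implicit Arguments.
Unset Strict Implicit.
Unset Printing Implicit Defensive.

Import Order.TTheory GRing.Theory Num.Theory.
Import numFieldNormedType.Exports.

Local Open Scope classical_set_scope.
Local Open Scope ring_scope.

(** Let X be the space of closed subsets of G. It is compact, Hausdorff and
    second countable, and G acts on it jointly continuously.

    Uniqueness and minimality come from one counting argument,
    [pattern_counting]. Let K be closed and U an open neighbourhood of K in X.
    Whether a closed set lies near K is visible, up to a small translation,
    from its trace on a ball of some fixed radius. So when t is large, linear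
    repetitivity copies the visits to K of one element x of the hull, made at
    places of the ball of radius t, into visits to U of any other element y,
    made at places of the ball of radius c t. If the places are sampled by a
    maximal separated net in each ball, the number of visits of x is at most
    that of y, while the sizes of the two nets differ by a factor that does not
    depend on t or on the mesh, because dilations make the covering constants
    scale invariant. Minimality is the special case of a net that contains the
    identity. Integrating the two counts gives nu(U) >= delta mu(K) for all
    invariant probabilities mu and nu, with one delta > 0, hence
    nu >= delta mu on Borel sets by regularity. Such a bound improves itself:
    (nu - delta mu) / (1 - delta) is again an invariant probability and so also
    dominates delta mu, and by iteration nu >= (1 - (1 - delta)^k) mu for all
    k, so nu >= mu and, by symmetry, nu = mu ([invariant_unique]).

    Existence needs an invariant average along an orbit, and covering numbers
    provide it. The number of e-balls needed to cover a bounded set is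
    invariant under left translations because the metric is, and it is additive
    on sets at distance at least 2 e. Its normalized ultralimit as e tends to 0
    is a left-invariant content on bounded sets, [vol], which is subadditive,
    and additive on sets at positive distance. It is doubling, and packing
    disjoint annuli into a ball of twice the radius shows that some balls have
    relatively small boundary layers ([folner_radius]). Averaging over such
    balls gives a left-invariant mean of subsets of G, and the mean of the
    return times of an orbit to a closed subset of the hull is a content on
    closed sets. A content on the closed sets of a compact Hausdorff space that
    is additive on disjoint sets induces a Borel measure, as in the proof of
    the Riesz representation theorem ([exists_invariant_measure]). *)

(** * Regularity of Borel probabilities *)

Section Regularity.
Context (R : realType) (T : ptopologicalType).
Notation borel := (g_sigma_algebraType (@open T)).
Variable mu : probability borel R.

Lemma open_borel (U : set T) : open U -> measurable (U : set borel).
Proof. exact: sub_sigma_algebra. Qed.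

Lemma closed_borel (F : set T) : closed F -> measurable (F : set borel).
Proof.
by move=> cF; rewrite -[F]setCK; apply: measurableC; apply: open_borel;
  exact: closed_openC.
Qed.

Lemma bigcup_tail_small (A : nat -> set borel) (e : R) :
  (forall i, measurable (A i)) -> 0 < e ->
  exists n, (mu (\bigcup_i A i `\` \big[setU/set0]_(i < n) A i) <= e%:E)%E.
Proof.
move=> mA e0; pose B n := \bigcup_i A i `\` \big[setU/set0]_(i < n) A i.
have mB n : measurable (B n).
  apply: measurableD; first exact: bigcup_measurable.
  by apply: bigsetU_measurable.
have B0 : \bigcap_n B n = set0.
  rewrite -subset0 => x Bx; have [[k _ Akx] _] := Bx 0%N I.
  have [_] := Bx k.+1 I; apply.
  by rewrite big_ord_recr; right.
have cB : (mu \o B) x @[x --> \oo] --> mu (\bigcap_n B n).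
  apply: nonincreasing_cvg_mu => //.
  - by rewrite ltey_eq fin_num_measure.
  - by rewrite B0.
  - move=> n m nm; apply/subsetPset; apply: setDS.
    exact: subset_bigsetU.
move: cB; rewrite B0 measure0 => /fine_cvgP[_] /cvgrPdist_le /(_ e e0) [N _].
move=> /(_ N (leqnn N)) /=; rewrite sub0r normrN ger0_norm ?fine_ge0// => h.
by exists N; rewrite -lee_fin fineK// in h; exact: fin_num_measure.
Qed.

Hypothesis open_Fsigma : forall U : set T, open U -> Fsigma U.

Definition sandwiched (E : set T) := forall e : R, 0 < e ->
  exists F U : set T,
    [/\ closed F, open U, F `<=` E, E `<=` U & (mu (U `\` F) <= e%:E)%E].

(** The union of the inner closed sets need not be closed; finitely many of them
    exhaust it up to a small measure, which is where finiteness of mu enters. *)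
Lemma sandwiched_bigcup (E : nat -> set borel) :
  (forall i, sandwiched (E i)) -> sandwiched (\bigcup_i E i).
Proof.
move=> sE e e0.
pose e_ i : R := e / 2 / (2 ^ i.+1)%:R.
have e_0 i : 0 < e_ i by rewrite !divr_gt0// ltr0n expn_gt0.
have /choice[FU FUP] : forall i, exists FU : set T * set T,
    [/\ closed FU.1, open FU.2, FU.1 `<=` E i, E i `<=` FU.2 &
        (mu (FU.2 `\` FU.1) <= (e_ i)%:E)%E].
  by move=> i; have [F [U ?]] := sE i _ (e_0 i); exists (F, U).
pose F i : set borel := (FU i).1; pose U i : set borel := (FU i).2.
have mF i : measurable (F i) by apply: closed_borel; have [] := FUP i.
have mU i : measurable (U i) by apply: open_borel; have [] := FUP i.
have [n hn] := bigcup_tail_small mF (divr_gt0 e0 (ltr0Sn R 1)).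
exists (\big[setU/set0]_(i < n) F i), (\bigcup_i U i); split.
- by apply: closed_bigsetU => i _; have [] := FUP i.
- by apply: bigcup_open => i _; have [] := FUP i.
- rewrite -bigcup_mkord => x [i _ Fx]; exists i => //.
  by have [_ _ + _ _] := FUP i; apply.
- by move=> x [i _ Ex]; exists i => //; have [_ _ _ + _] := FUP i; apply.
pose A := \bigcup_i (U i `\` F i).
pose B := \bigcup_i F i `\` \big[setU/set0]_(i < n) F i.
have mA : measurable A by apply: bigcup_measurable => i _; apply: measurableD.
have mB : measurable B.
  apply: measurableD; first exact: bigcup_measurable.
  exact: bigsetU_measurable.
apply: (@le_trans _ _ (mu (A `|` B))).
  apply: le_measure; rewrite ?inE//.
  - apply: measurableD; first exact: bigcup_measurable.
    exact: bigsetU_measurable.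
  - exact: measurableU.
  move=> x [[i _ Ux] nF]; have [Fx|nFx] := pselect ((\bigcup_i F i) x).
    by right.
  by left; exists i => //; split => // Fix; apply: nFx; exists i.
apply: (le_trans (measureU2 _ mA mB)).
rewrite [e in leRHS]splitr EFinD; apply: leeD => //.
have le1 : (mu A <= \sum_(0 <= i <oo) mu (U i `\` F i))%E.
  by apply: measure_sigma_subadditive => // i; apply: measurableD.
apply: (le_trans le1).
apply: (@le_trans _ _ (\sum_(0 <= i <oo) (e_ i)%:E)%E).
  by apply: lee_nneseries => // i _; have [] := FUP i.
by apply: (epsilon_trick0 xpredT); rewrite divr_ge0// ltW.
Qed.

(** The sandwiched sets form a sigma-algebra, and it contains the open sets
    because these are increasing unions of closed sets. *)
Lemma borel_regular (E : set borel) : measurable E -> sandwiched E.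
Proof.
apply: smallest_sub; last first.
  move=> U oU e e0; have [F cF UF] := open_Fsigma oU.
  have mF i : measurable (F i : set borel) by exact: closed_borel.
  have [n hn] := bigcup_tail_small mF e0.
  exists (\big[setU/set0]_(i < n) F i), U; split => //; last by rewrite UF.
    exact: closed_bigsetU.
  by rewrite UF -bigcup_mkord => x [i _ Fx]; exists i.
split.
- move=> e e0; exists set0, set0; split=> //; [exact: closed0|exact: open0|].
  by rewrite setD0 measure0 lee_fin ltW.
- move=> A sA e /sA[F [U [cF oU FA AU le]]]; exists (~` U), (~` F); split.
  + exact: open_closedC.
  + exact: closed_openC.
  + by rewrite setTD; exact: subsetC.
  + by rewrite setTD; exact: subsetC.
  + by rewrite setDE setCK setIC -setDE.
- exact: sandwiched_bigcup.
Qed.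

Lemma borel_inner_closed (E : set borel) (e : R) : measurable E -> 0 < e ->
  exists2 F : set T, closed F & F `<=` E /\ (mu E <= mu F + e%:E)%E.
Proof.
move=> mE e0; have [F [U [cF oU FE EU le]]] := borel_regular mE e0.
have mF := closed_borel cF; have mU := open_borel oU.
exists F => //; split=> //; rewrite (measureDI mu mE mF) addeC setIidr//.
rewrite leeD2l// (le_trans _ le)// le_measure ?inE//; try exact: measurableD.
exact: setSD.
Qed.

Lemma borel_outer_open (E : set borel) (e : R) : measurable E -> 0 < e ->
  exists2 U : set T, open U & E `<=` U /\ (mu U <= mu E + e%:E)%E.
Proof.
move=> mE e0; have [F [U [cF oU FE EU le]]] := borel_regular mE e0.
have mF := closed_borel cF; have mU := open_borel oU.
exists U => //; split=> //; rewrite (measureDI mu mU mE) addeC setIidr//.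
rewrite leeD2l// (le_trans _ le)// le_measure ?inE//; try exact: measurableD.
exact: setDS.
Qed.

End Regularity.

(** * Uniqueness of invariant probabilities *)
Section CountComparison.
Context (R : realType) (T : ptopologicalType) (I : Type).
Notation borel := (g_sigma_algebraType (@open T)).

Lemma sum_measure_integral_count (mu : probability borel R)
    (E : I -> set borel) (s : seq I) : (forall i, measurable (E i)) ->
  (\sum_(i <- s) mu (E i) =
   \int[mu]_x ((count (fun i => `[< E i x >]) s)%:R : R)%:E)%E.
Proof.
move=> mE; transitivity (\int[mu]_x (\sum_(i <- s) (\1_(E i) x : R)%:E))%E.
  rewrite ge0_integral_sum//; last first.
    by move=> i; apply/measurable_EFinP; exact: measurable_indic.
  by apply: eq_bigr => i _; rewrite integral_indic// setIT.
apply: eq_integral => x _; rewrite sumEFin; congr (_%:E).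
elim: s => [|i s IH]; first by rewrite big_nil.
by rewrite big_cons IH /= natrD; congr (_ + _).
Qed.

(** The largest value N of the first count separates the two integrands, so both
    integrals compare with the integral of the constant N. *)
Lemma sum_measure_le_count (mu nu : probability borel R)
    (E F : I -> set borel) (s t : seq I) :
  (forall i, measurable (E i)) -> (forall i, measurable (F i)) ->
  (forall x y, (count (fun i => `[< E i x >]) s
                <= count (fun i => `[< F i y >]) t)%N) ->
  (\sum_(i <- s) mu (E i) <= \sum_(i <- t) nu (F i))%E.
Proof.
move=> mE mF le.
have mcount (G : I -> set borel) r : (forall i, measurable (G i)) ->
    measurable_fun setT
      (fun x => (count (fun i => `[< G i x >]) r)%:R%:E : \bar R).
  move=> mG; apply/measurable_EFinP.
  rewrite [X in measurable_fun _ X](_ : _ =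
      fun x => \sum_(i <- r) (\1_(G i) x : R)).
    by apply: measurable_sum => i; exact: measurable_indic.
  apply/funext => x; elim: r => [|i r IH]; first by rewrite big_nil.
  by rewrite big_cons -IH /= natrD; congr (_ + _).
have intc (rho : probability borel R) (N : nat) :
    (\int[rho]_x (N%:R : R)%:E = N%:R%:E)%E.
  rewrite integral_cst// -[RHS]mule1; congr (_ * _)%E.
  exact: probability_setT.
pose P n := `[< exists x, n = count (fun i => `[< E i x >]) s >].
have exP : exists n, P n.
  by exists (count (fun i => `[< E i point >]) s); apply/asboolP; exists point.
have leP n : P n -> (n <= size s)%N by move=> /asboolP[x ->]; exact: count_size.
case: (ex_maxnP exP leP) => N /asboolP[x0 NE] Nmax.
rewrite !sum_measure_integral_count//; apply: (@le_trans _ _ (N%:R%:E)%E).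
  rewrite -(intc mu); apply: ge0_le_integral => //; first exact: mcount.
  move=> x _; rewrite lee_fin ler_nat; apply: Nmax.
  by apply/asboolP; exists x.
rewrite -(intc nu); apply: ge0_le_integral => //; first exact: mcount.
by move=> y _; rewrite lee_fin ler_nat NE.
Qed.

End CountComparison.

Section Subtraction.
Context d (R : realType) (T : measurableType d) (mu nu : probability T R).
Variable delta : R.
Hypothesis delta_lt1 : delta < 1.
Hypothesis dom : forall E, measurable E -> (delta%:E * mu E <= nu E)%E.

(** Truncating at 0 makes the function nonnegative on nonmeasurable sets too, as
    the structure of measures requires. *)
Definition subtracted (E : set T) : \bar R :=
  (Num.max 0 ((fine (nu E) - delta * fine (mu E)) / (1 - delta)))%:E.

Lemma subtractedE E : measurable E ->
  subtracted E = ((fine (nu E) - delta * fine (mu E)) / (1 - delta))%:E.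
Proof.
move=> mE; rewrite /subtracted max_r// divr_ge0 ?subr_ge0//; last exact: ltW.
have := dom mE; rewrite -[mu E]fineK ?fin_num_measure//.
by rewrite -[nu E]fineK ?fin_num_measure.
Qed.

Let subtracted0 : subtracted set0 = 0%E.
Proof. by rewrite subtractedE// !measure0 mulr0 subr0 mul0r. Qed.

Let subtracted_ge0 E : (0 <= subtracted E)%E.
Proof. by rewrite /subtracted lee_fin le_max lexx. Qed.

Let subtracted_sigma_additive : semi_sigma_additive subtracted.
Proof.
move=> A mA tA mUA; rewrite subtractedE//.
have cv (rho : probability T R) :
    (fun n => \sum_(0 <= i < n) fine (rho (A i))) @ \oo -->
    fine (rho (\bigcup_i A i)).
  have := @measure_semi_sigma_additive _ _ _ rho A mA tA mUA.
  rewrite -[X in _ --> X -> _]fineK ?fin_num_measure// => /fine_cvgP[_].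
  apply: cvg_trans; apply: near_eq_cvg; apply: nearW => n /=.
  by rewrite sum_fine// => i _; exact: fin_num_measure.
have cB : (fun n => (\sum_(0 <= i < n) fine (nu (A i)) -
    delta * \sum_(0 <= i < n) fine (mu (A i))) / (1 - delta)) @ \oo -->
    (fine (nu (\bigcup_i A i)) - delta * fine (mu (\bigcup_i A i)))
      / (1 - delta).
  by apply: cvgMl; apply: cvgB; [exact: cv|apply: cvgMr; exact: cv].
rewrite (_ : (fun n => _) = EFin \o (fun n =>
    (\sum_(0 <= i < n) fine (nu (A i)) -
      delta * \sum_(0 <= i < n) fine (mu (A i))) / (1 - delta))).
  by apply: cvg_EFin; [exact: nearW|exact: cB].
apply/funext => n /=; rewrite mulr_sumr -sumrB mulr_suml -sumEFin.
by apply: eq_bigr => i _; rewrite subtractedE.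
Qed.

HB.instance Definition _ := isMeasure.Build _ _ _ subtracted
  subtracted0 subtracted_ge0 subtracted_sigma_additive.

Let subtracted_setT : subtracted setT = 1%E.
Proof.
by rewrite subtractedE// !probability_setT mulr1 divff// subr_eq0 gt_eqF.
Qed.

HB.instance Definition _ :=
  Measure_isProbability.Build _ _ _ subtracted subtracted_setT.

(** The part of nu that is left after removing delta mu, renormalized to a
    probability. *)
Lemma probability_subtract : exists la : probability T R,
  forall E, measurable E ->
    (nu E = delta%:E * mu E + (1 - delta)%:E * la E)%E.
Proof.
have key E : measurable E ->
    (nu E = delta%:E * mu E + (1 - delta)%:E * subtracted E)%E.
  move=> mE; rewrite subtractedE// -[mu E in RHS]fineK ?fin_num_measure//.
  rewrite -[LHS]fineK ?fin_num_measure// -!EFinM -EFinD; congr (_%:E).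
  have : 1 - delta != 0 by rewrite subr_eq0 gt_eqF.
  by move=> h; field.
by exists subtracted.
Qed.

End Subtraction.

Section Uniqueness.
Context (R : realType) (T : ptopologicalType) (I : Type) (act : I -> T -> T).
Notation borel := (g_sigma_algebraType (@open T)).
Hypothesis act_continuous : forall i, continuous (act i).
Hypothesis open_Fsigma : forall U : set T, open U -> Fsigma U.

Definition act_invariant (mu : set borel -> \bar R) :=
  forall i (E : set borel), measurable E -> mu (act i @^-1` E) = mu E.

(** The combinatorial form of proportional domination: at some sampling scale,
    every point visits U at least delta times as often, relatively to the number
    of samples, as any other point visits K. *)
Definition count_dominated (delta : R) := forall K U : set T,
  closed K -> open U -> K `<=` U -> exists s t : seq I,
    [/\ (0 < size t)%N, delta * (size t)%:R <= (size s)%:R &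
        forall x y, (count (fun i => `[< K (act i x) >]) s
                     <= count (fun i => `[< U (act i y) >]) t)%N].

Lemma act_borel i (E : set borel) :
  measurable E -> measurable (act i @^-1` E : set borel).
Proof.
move: E; apply: smallest_sub; last first.
  move=> U oU; apply: open_borel; apply: open_comp oU => x _.
  exact: act_continuous.
split=> [|A mA|A mA].
- by rewrite preimage_set0; exact: measurable0.
- by rewrite setTD preimage_setC; exact: measurableC.
- by rewrite preimage_bigcup; exact: bigcup_measurable.
Qed.

Variable delta : R.
Hypotheses (delta_gt0 : 0 < delta) (delta_lt1 : delta < 1).
Hypothesis dominated : count_dominated delta.

(** By invariance each term of the sum over s of the measures of the preimages
    of K is mu K, and likewise for t and U; so the comparison of counts becomes
    size s * mu K <= size t * nu U. *)
Lemma invariant_open_ge (mu nu : probability borel R) (K U : set T) :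
  act_invariant mu -> act_invariant nu -> closed K -> open U -> K `<=` U ->
  (delta%:E * mu K <= nu U)%E.
Proof.
move=> imu inu cK oU KU; have [s [t [t0 st le]]] := dominated cK oU KU.
have mK := closed_borel cK; have mU := open_borel oU.
have := @sum_measure_le_count R T I mu nu (fun i => act i @^-1` K)
  (fun i => act i @^-1` U) s t (fun i => act_borel i mK)
  (fun i => act_borel i mU) le.
under eq_bigr do rewrite imu//.
under [X in (_ <= X)%E]eq_bigr do rewrite inu//.
have {}imu : mu K \is a fin_num by exact: fin_num_measure.
have {}inu : nu U \is a fin_num by exact: fin_num_measure.
have := measure_ge0 mu K.
rewrite -(fineK imu) -(fineK inu) !sumEFin -EFinM !lee_fin.
rewrite !big_const_seq !count_predT !iter_addr_0 => mu0.
rewrite -[X in X <= _]mulr_natr -[X in _ <= X]mulr_natr => h.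
have t0' : 0 < (size t)%:R :> R by rewrite ltr0n.
rewrite -(ler_pM2r t0') (le_trans _ h)//.
by rewrite mulrAC [leRHS]mulrC ler_wpM2r ?fine_ge0.
Qed.

(** Regularity of both measures from opposite sides: a closed set inside E that
    almost exhausts it for mu, and an open set around E almost equal to it for
    nu. *)
Lemma invariant_ge (mu nu : probability borel R) (E : set borel) :
  act_invariant mu -> act_invariant nu -> measurable E ->
  (delta%:E * mu E <= nu E)%E.
Proof.
move=> imu inu mE; apply/lee_addgt0Pr => e e0.
have e20 := divr_gt0 e0 (ltr0Sn R 1).
have [F cF [FE muF]] := borel_inner_closed mu open_Fsigma mE e20.
have [U oU [EU nuU]] := borel_outer_open nu open_Fsigma mE e20.
have FU : F `<=` U by exact: subset_trans EU.
have := invariant_open_ge imu inu cF oU FU.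
move: muF nuU.
have fin (rho : probability borel R) A :
    measurable A -> rho A = (fine (rho A))%:E.
  by move=> mA; rewrite fineK// fin_num_measure.
rewrite (fin mu E)// (fin nu E)// (fin mu F (closed_borel cF)).
rewrite (fin nu U (open_borel oU)).
rewrite -!EFinD -!EFinM !lee_fin => h1 h2 h3.
have h4 := ler_wpM2l (ltW delta_gt0) h1.
have h5 : delta * (e / 2) <= e / 2 by rewrite ger_pMl// ltW.
by lra.
Qed.

(** The remainder la = (nu - delta mu) / (1 - delta) is invariant, so the
    induction hypothesis applies to it and adds (1 - delta) times the previous
    factor to delta. *)
Lemma invariant_ge_geometric k (mu nu : probability borel R) (E : set borel) :
  act_invariant mu -> act_invariant nu -> measurable E ->
  (1 - (1 - delta) ^+ k) * fine (mu E) <= fine (nu E).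
Proof.
elim: k mu nu E => [|k IH] mu nu E imu inu mE.
  by rewrite expr0 subrr mul0r fine_ge0.
have [la laE] := probability_subtract delta_lt1
  (fun E mE => invariant_ge imu inu mE).
have fE F : measurable F ->
    fine (nu F) = delta * fine (mu F) + (1 - delta) * fine (la F).
  move=> mF; rewrite laE// -[mu F]fineK ?fin_num_measure//.
  by rewrite -[la F]fineK ?fin_num_measure// -!EFinM -EFinD.
have d1 : 0 < 1 - delta by rewrite subr_gt0.
have ila : act_invariant la.
  move=> i F mF; have mG := act_borel i mF.
  rewrite -[LHS]fineK ?fin_num_measure// -[RHS]fineK ?fin_num_measure//.
  congr (_%:E); apply: (mulfI (lt0r_neq0 d1)).
  have := fE _ mG; rewrite inu// imu// fE// => /addrI h.
  by rewrite h.
rewrite fE// exprS; have := IH _ _ _ imu ila mE.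
move: (fine (mu E)) (fine (la E)) (_ ^+ k) => a b c h.
have -> : (1 - (1 - delta) * c) * a = delta * a + (1 - delta) * ((1 - c) * a).
  by ring.
by rewrite lerD2l ler_pM2l.
Qed.

Lemma invariant_le (mu nu : probability borel R) (E : set borel) :
  act_invariant mu -> act_invariant nu -> measurable E -> (mu E <= nu E)%E.
Proof.
move=> imu inu mE.
rewrite -[X in (X <= _)%E]fineK ?fin_num_measure//.
rewrite -[X in (_ <= X)%E]fineK ?fin_num_measure// lee_fin.
have cv : (1 - (1 - delta) ^+ k) * fine (mu E) @[k --> \oo] -->
    (1 - 0) * fine (mu E).
  apply: cvgMl; apply: cvgB; first exact: cvg_cst.
  by apply: cvg_expr; rewrite ger0_norm ?subr_ge0 1?ltW// ltrBlDr ltrDl.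
rewrite -[leLHS]mul1r -[X in X * _]subr0.
apply: (ler_cvg_to cv (cvg_cst _)); apply: nearW => k.
exact: invariant_ge_geometric.
Qed.

Theorem invariant_unique (mu nu : probability borel R) (E : set borel) :
  act_invariant mu -> act_invariant nu -> measurable E -> nu E = mu E.
Proof.
by move=> imu inu mE; apply/eqP; rewrite eq_le !invariant_le.
Qed.

End Uniqueness.

(** * From contents on closed sets to invariant measures *)
Section ContentMeasure.
Context (R : realType) (T : ptopologicalType).
Hypotheses (T_hausdorff : hausdorff_space T) (T_compact : compact [set: T]).
Variable m : set T -> R.
Hypothesis m_mono : forall F K, closed F -> closed K -> F `<=` K -> m F <= m K.
Hypothesis m_subadd : forall F K, closed F -> closed K ->
  m (F `|` K) <= m F + m K.
Hypothesis m_add : forall F K, closed F -> closed K -> F `&` K = set0 ->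
  m F + m K <= m (F `|` K).
Hypothesis m_setT : m setT = 1.

Lemma content0 : m set0 = 0.
Proof.
have c0 := @closed0 T; apply/eqP; rewrite eq_le.
have := m_add c0 c0 (setI0 _); have := m_subadd c0 c0; rewrite setU0.
by move=> *; apply/andP; split; lra.
Qed.

Local Open Scope ereal_scope.

Definition inner_content (U : set T) : \bar R :=
  ereal_sup [set (m K)%:E | K in [set K | closed K /\ K `<=` U]].

(** As in the construction of Radon measures: approximation of open sets from
    inside, and of all other sets from outside. *)
Definition content_outer (E : set T) : \bar R :=
  ereal_inf [set inner_content U | U in [set U | open U /\ E `<=` U]].

Lemma le_inner_content K U :
  closed K -> K `<=` U -> (m K)%:E <= inner_content U.
Proof. by move=> cK KU; apply: ereal_sup_ubound; exists K. Qed.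

Lemma inner_content_ge0 U : 0 <= inner_content U.
Proof. by rewrite -[0]/(0%:E) -content0 le_inner_content//; exact: closed0. Qed.

Lemma inner_content_le1 U : inner_content U <= 1.
Proof.
apply: ge_ereal_sup => _ [K [cK _] <-]; rewrite lee_fin -m_setT.
by apply: m_mono => //; exact: closedT.
Qed.

Lemma inner_content_sub U V : U `<=` V -> inner_content U <= inner_content V.
Proof.
move=> UV; apply: ge_ereal_sup => _ [K [cK KU] <-].
by apply: le_inner_content => //; exact: subset_trans UV.
Qed.

Lemma content_outer_le E U : open U -> E `<=` U ->
  content_outer E <= inner_content U.
Proof. by move=> oU EU; apply: ereal_inf_lbound; exists U. Qed.

Lemma content_outer_open U : open U -> content_outer U = inner_content U.
Proof.
move=> oU; apply/eqP; rewrite eq_le content_outer_le//=.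
by apply: le_ereal_inf_tmp => _ [V [oV UV] <-]; exact: inner_content_sub.
Qed.

Lemma content_outer_ge0 E : 0 <= content_outer E.
Proof. by apply: le_ereal_inf_tmp => _ [U _ <-]; exact: inner_content_ge0. Qed.

Lemma content_outer_le1 E : content_outer E <= 1.
Proof.
apply: (le_trans (content_outer_le openT (@subsetT _ E))).
exact: inner_content_le1.
Qed.

Lemma content_outer_fin E : content_outer E \is a fin_num.
Proof.
rewrite fin_numElt (lt_le_trans _ (content_outer_ge0 E)) ?ltNyr//=.
by rewrite (le_lt_trans (content_outer_le1 E)) ?ltry.
Qed.

Lemma content_outer_sub : {homo content_outer : A B / A `<=` B >-> A <= B}.
Proof.
move=> A B AB; apply: le_ereal_inf_tmp => _ [U [oU BU] <-].
by apply: content_outer_le => //; exact: subset_trans BU.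
Qed.

(** Normality provides the room needed to cut a closed set along two open
    sets. *)
Lemma closed_split K (U V : set T) : closed K -> open U -> open V ->
  K `<=` U `|` V -> exists F H,
    [/\ closed F, closed H, F `<=` U, H `<=` V & K = F `|` H].
Proof.
move=> cK oU oV KUV.
have cKU : closed (K `\` U) by apply: closedI => //; exact: open_closedC.
have KUsV : K `\` U `<=` V by move=> x [Kx nUx]; have [] := KUV x Kx.
have /(compact_normal T_hausdorff T_compact cKU) : set_nbhs (K `\` U) V.
  by apply/set_nbhsP; exists V; split.
move=> [W /set_nbhsP[Z [oZ KZ ZW]] WV].
exists (K `\` Z), (K `&` closure W); split.
- by apply: closedI => //; exact: open_closedC.
- by apply: closedI => //; exact: closed_closure.
- by move=> x [Kx nZ]; apply: contrapT => nU; apply: nZ; exact: KZ.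
- by move=> x [_ /WV].
apply/seteqP; split=> [x Kx|x [|] []//].
have [Zx|nZx] := pselect (Z x); last by left.
by right; split => //; apply: subset_closure; exact: ZW.
Qed.

Lemma content_finite_cover (U : nat -> set T) n K : closed K ->
  (forall i, open (U i)) -> K `<=` \big[setU/set0]_(i < n) U i ->
  (m K)%:E <= \sum_(i < n) inner_content (U i).
Proof.
move=> + oU; elim: n K => [K _|n IH K cK].
  by rewrite !big_ord0 subset0 => ->; rewrite content0.
rewrite !big_ord_recr /= => KU.
have oUn : open (\big[setU/set0]_(i < n) U i).
  by rewrite -bigcup_mkord; exact: bigcup_open.
have [F [H [cF cH FU HU ->]]] := closed_split cK oUn (oU n) KU.
apply: (@le_trans _ _ ((m F)%:E + (m H)%:E)).
  by rewrite -EFinD lee_fin m_subadd.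
by apply: leeD; [exact: IH|exact: le_inner_content].
Qed.

(** Compactness reduces a countable open cover of a closed set to a finite one,
    for which [content_finite_cover] applies. *)
Lemma content_outer_sigma_subadditive : sigma_subadditive content_outer.
Proof.
move=> E; apply/lee_addgt0Pr => e e0.
have trick := epsilon_trick xpredT (fun i => content_outer_ge0 (E i)) (ltW e0).
apply: (le_trans _ trick).
have /choice[U UP] : forall i, exists U, [/\ open U, E i `<=` U &
    inner_content U <= content_outer (E i) + (e / (2 ^ i.+1)%:R)%:E].
  move=> i; have ei : (0 < e / (2 ^ i.+1)%:R)%R.
    by rewrite divr_gt0// ltr0n expn_gt0.
  have [_ [U [oU EU] <-] lt] :=
    lb_ereal_inf_adherent ei (content_outer_fin (E i)).
  by exists U; split => //; exact: ltW.
apply: (@le_trans _ _ (\sum_(0 <= i <oo) inner_content (U i))); last first.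
  apply: lee_nneseries => [i _ _|i _]; first exact: inner_content_ge0.
  by have [] := UP i.
have oU i : open (U i) by have [] := UP i.
apply: (@le_trans _ _ (inner_content (\bigcup_i U i))).
  apply: content_outer_le; first exact: bigcup_open.
  by move=> x [i _ Ex]; exists i => //; have [_ + _] := UP i; apply.
apply: ge_ereal_sup => _ [K [cK KU] <-].
have [n Kn] : exists n, K `<=` \big[setU/set0]_(i < n) U i.
  have : compact K by apply: (subclosed_compact cK T_compact).
  rewrite compact_cover => /(_ nat setT U (fun i _ => oU i) KU) [D _ KD].
  exists (\max_(i <- finmap.enum_fset D) i.+1)%N => x /KD[i iD Ux].
  rewrite -bigcup_mkord; exists i => //=.
  exact: (@leq_bigmax_seq _ (finmap.enum_fset D) xpredT (fun i => i.+1) i iD).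
apply: (le_trans (content_finite_cover cK oU Kn)).
rewrite -(big_mkord xpredT (fun i => inner_content (U i))).
by apply: nneseries_lim_ge => i _ _; exact: inner_content_ge0.
Qed.

Lemma content_outer0 : content_outer set0 = 0.
Proof.
rewrite content_outer_open; last exact: open0.
apply/eqP; rewrite eq_le inner_content_ge0 andbT.
apply: ge_ereal_sup => _ [K [_ K0] <-].
by move: K0; rewrite subset0 => ->; rewrite content0.
Qed.

HB.instance Definition _ := isOuterMeasure.Build R T content_outer
  content_outer0 content_outer_ge0 content_outer_sub
  content_outer_sigma_subadditive.

(** Inside an open V around X, first exhaust the intersection of V and U by a
    closed K, then what remains of V outside K by a closed H; additivity of m
    on the disjoint sets K and H bounds the sum of the two parts by the content
    of V. *)
Lemma open_content_caratheodory U : open U ->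
  content_outer.-caratheodory U.
Proof.
move=> oU; apply: le_caratheodory_measurable => X.
apply: le_ereal_inf_tmp => _ [V [oV XV] <-].
have oVU : open (V `&` U) by exact: openI.
rewrite -leeBrDr ?content_outer_fin//.
apply: (@le_trans _ _ (inner_content (V `&` U))).
  by apply: content_outer_le => //; exact: setSI.
apply: ge_ereal_sup => _ [K [cK KVU] <-].
rewrite leeBrDr ?content_outer_fin// -leeBrDl//.
apply: (@le_trans _ _ (inner_content (V `\` K))).
  apply: content_outer_le; first by apply: openI => //; exact: closed_openC.
  by move=> x [Xx nU]; split; [exact: XV|move=> /KVU[]].
apply: ge_ereal_sup => _ [H [cH HVK] <-].
rewrite leeBrDl// -EFinD; apply: (@le_trans _ _ (m (K `|` H))%:E).
  rewrite lee_fin m_add// -subset0 => x [Kx /HVK[]] //.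
apply: le_inner_content; first exact: closedU.
by move=> x [/KVU[]|/HVK[]].
Qed.

Notation borel := (g_sigma_algebraType (@open T)).

Definition content_measure : set borel -> \bar R := content_outer.

Lemma borel_content_caratheodory (E : set borel) : measurable E ->
  content_outer.-caratheodory E.
Proof.
apply: smallest_sub; last exact: open_content_caratheodory.
split=> [|A|A].
- exact: caratheodory_measurable_set0.
- by rewrite setTD; exact: caratheodory_measurable_setC.
- exact: caratheodory_measurable_bigcup.
Qed.

Let content_measure_sigma_additive : semi_sigma_additive content_measure.
Proof.
move=> A mA tA mUA; apply: caratheodory_measure_sigma_additive => //.
- by move=> i; exact: borel_content_caratheodory.
- exact: borel_content_caratheodory.
Qed.

HB.instance Definition _ := isMeasure.Build _ _ _ content_measure
  content_outer0 content_outer_ge0 content_measure_sigma_additive.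

Let content_measure_setT : content_measure setT = 1.
Proof.
rewrite /content_measure content_outer_open; last exact: openT.
apply/eqP; rewrite eq_le inner_content_le1 -[1]/(1%:E) -m_setT.
by rewrite le_inner_content//; exact: closedT.
Qed.

HB.instance Definition _ :=
  Measure_isProbability.Build _ _ _ content_measure content_measure_setT.

(** Invariance of m on closed sets passes to the outer measure because
    preimages by the homeomorphism g match closed sets inside U with closed
    sets inside its preimage. *)
Lemma content_outer_preimage_le (g h : T -> T) E :
  continuous g -> continuous h -> cancel g h -> cancel h g ->
  (forall K, closed K -> m (g @^-1` K) = m K) ->
  content_outer (g @^-1` E) <= content_outer E.
Proof.
move=> cg ch gK hK mg; apply: le_ereal_inf_tmp => _ [U [oU EU] <-].
apply: (@le_trans _ _ (inner_content (g @^-1` U))).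
  apply: content_outer_le; first by apply: open_comp oU => x _; exact: cg.
  exact: preimage_subset.
apply: ge_ereal_sup => _ [K [cK KU] <-].
have cH : closed (h @^-1` K) by apply: preimage_closed cK => x _; exact: ch.
rewrite (_ : K = g @^-1` (h @^-1` K)); last first.
  by apply/seteqP; split => x /=; rewrite gK.
by rewrite mg//; apply: le_inner_content => // x /KU /=; rewrite hK.
Qed.

Theorem exists_invariant_measure (I : Type) (act inv : I -> T -> T) :
  (forall i, continuous (act i)) -> (forall i, continuous (inv i)) ->
  (forall i, cancel (act i) (inv i)) -> (forall i, cancel (inv i) (act i)) ->
  (forall i K, closed K -> m (act i @^-1` K) = m K) ->
  exists mu : probability borel R, act_invariant act mu.
Proof.
move=> ca ci aK iK ma; exists content_measure => i E mE.
apply/eqP; rewrite eq_le; apply/andP; split.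
  by apply: (content_outer_preimage_le _ (ca i) (ci i)) => // K; exact: ma.
rewrite -[X in content_measure X <= _](_ : inv i @^-1` (act i @^-1` E) = E).
  apply: (content_outer_preimage_le _ (ci i) (ca i)) => // K cK.
  rewrite -(ma i); last by apply: preimage_closed cK => x _; exact: ci.
  by congr m; apply/seteqP; split => x /=; rewrite aK.
by apply/seteqP; split => x /=; rewrite iK.
Qed.

End ContentMeasure.

(** * The Chabauty-Fell topology *)
Section SecondCountable.
Context {T : topologicalType}.

Lemma countable_sub_range (B : set (set T)) : countable B ->
  exists b : nat -> set T, B `<=` range b.
Proof.
move=> cB; have [f finj] := (elimT (countable_injP _)) cB.
pose b n := xget set0 [set U | B U /\ f U = n].
exists b => U BU; exists (f U) => //; rewrite /b.
case: xgetP => [V _ [BV fV]|/(_ U)]; last by case.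
by apply: finj; rewrite ?inE.
Qed.

(** Regularity: an open set is the union of the closures, contained in it, of
    the members of a countable base. *)
Lemma compact_hausdorff_open_Fsigma (U : set T) : hausdorff_space T ->
  compact [set: T] -> @second_countable T -> open U -> Fsigma U.
Proof.
move=> hT cT [B /countable_sub_range[b Bb] [Bo Bn]] oU.
exists (fun n => [set x | closure (b n) `<=` U /\ closure (b n) x]).
  move=> n; have [h|h] := pselect (closure (b n) `<=` U).
    rewrite (_ : [set _ | _] = closure (b n)); first exact: closed_closure.
    by apply/seteqP; split => x // [].
  rewrite (_ : [set _ | _] = set0); first exact: closed0.
  by rewrite -subset0 => x [].
apply/seteqP; split=> [x Ux|x [n _ [bU bx]]]; last exact: bU.
have [V nV VU] := compact_regular hT cT filterT (open_nbhs_nbhs (conj oU Ux)).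
have [W [BW Wx] WV] := Bn x V nV; have [n _ bn] := Bb _ BW.
exists n => //=; rewrite bn; split; last exact: subset_closure.
exact: subset_trans (closureS WV) VU.
Qed.

End SecondCountable.

Section FellTopology.
Context (T : topologicalType).
Implicit Types (A B C : closedSet T) (O : set (closedSet T)).

Definition hits (U : set T) := [set C : closedSet T | C `&` U !=set0].

Definition misses (K : set T) := [set C : closedSet T | C `&` K = set0].

Lemma fell_basis O C : open O -> O C -> exists s : seq (bool * set T),
  (forall i, i \in s -> fell_index i /\ fell_subbase i C) /\
  (forall C', (forall i, i \in s -> fell_subbase i C') -> O C').
Proof.
move=> [I hI <-] [S IS SC]; have [s sD sE] := hI _ IS; rewrite -sE in SC.
exists (finmap.enum_fset s); split.
  by move=> i si; split; [have := sD _ si; rewrite inE|exact: SC].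
by move=> C' sC'; exists S => //; rewrite -sE.
Qed.

Lemma fell_cvg (F : set_system (closedSet T)) C : Filter F ->
  (forall i, fell_index i -> fell_subbase i C -> F (fell_subbase i)) -> F --> C.
Proof.
move=> FF h O; rewrite nbhsE => -[Q [oQ QC] QO].
have [s [sC sQ]] := fell_basis oQ QC.
apply: (@filterS _ F _ [set C' | forall i, i \in s -> fell_subbase i C']).
  by move=> C' /sQ /QO.
elim: s {sQ} sC => [_|i s IH sC]; first exact: filterS filterT.
have [iD iC] := sC i (mem_head _ _).
have Fs := IH (fun j js => sC j (mem_behead (s := i :: s) js)).
apply: filterS (filterI (h i iD iC) Fs) => C' [iC' sC'] j.
by rewrite inE => /orP[/eqP ->|/sC'].
Qed.

(** An ultrafilter of closed sets converges to the set of the points all of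
    whose open neighbourhoods are hit by almost every member. *)
Lemma fell_compact : compact [set: closedSet T].
Proof.
rewrite compact_ultra => F UF _.
pose L := [set x : T | forall U, open U -> U x -> F (hits U)].
have cL : closed L.
  move=> x clx U oU Ux; have [y [Ly Uy]] := clx U (open_nbhs_nbhs (conj oU Ux)).
  exact: Ly.
exists (ClosedSet cL); split => //; apply: fell_cvg => -[[] S] /= hS.
  by move=> [x [Lx Sx]]; exact: Lx.
move=> LS; have /compact_near_coveringP hcov := hS.
have FF : Filter F by exact: filter_filter.
have : \near F, S `<=` (fun x => ~ cset F x).
  apply: (hcov _ F (fun C x => ~ cset C x)) => x Sx.
  have /existsNP[U /not_implyP[oU /not_implyP[Ux nF]]] : ~ L x.
    by move=> Lx; have : (L `&` S) x by []; rewrite LS.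
  exists (U, misses U) => /=.
    split; first exact: open_nbhs_nbhs.
    have [//|] := in_ultra_setVsetC (hits U) UF.
    apply: filterS => C /= /nonemptyPn //.
  move=> [y C] /= [Uy CU] Cy; have : (C `&` U) y by [].
  by rewrite CU.
apply: filterS => C SC; rewrite /fell_subbase /= -subset0 => x [Cx /SC]; exact.
Qed.

Definition compact_nbhs_basis := forall (x : T) (U : set T), nbhs x U ->
  exists K, [/\ compact K, nbhs x K & K `<=` U].

Hypothesis T_lc : compact_nbhs_basis.

Lemma fell_open_hit (U : set T) : open U -> open (hits U).
Proof. by move=> oU; exact: (@fell_subbase_open T (true, U)). Qed.

Lemma fell_open_miss (K : set T) : compact K -> open (misses K).
Proof. by move=> cK; exact: (@fell_subbase_open T (false, K)). Qed.

(** A point x of A outside B has a compact neighbourhood missing B: hitting its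
    interior and missing it are disjoint conditions. *)
Lemma fell_hausdorff : hausdorff_space (closedSet T).
Proof.
have sep A B x : cset A x -> ~ cset B x ->
    exists UV : set (closedSet T) * set (closedSet T),
      [/\ UV.1 A, UV.2 B, open UV.1, open UV.2 & UV.1 `&` UV.2 = set0].
  move=> Ax Bx; have nB : nbhs x (~` B).
    by apply: open_nbhs_nbhs; split; first exact/closed_openC/cset_closed.
  have [K [cK nK KB]] := T_lc nB.
  exists (hits K°, misses K); split => /=.
  - by exists x; split => //; exact: nK.
  - by rewrite /misses /= -subset0 => y [By /KB]; exact.
  - by apply: fell_open_hit; exact: open_interior.
  - exact: fell_open_miss.
  - rewrite -subset0 => C [[y [Cy Ky]] CK].
    by have : (C `&` K) y; [split => //; exact: interior_subset|rewrite CK].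
rewrite open_hausdorff => A B AB.
have [[x [Ax Bx]]|nAB] := pselect (exists x, cset A x /\ ~ cset B x).
  have [[U V] /= [UA VB oU oV UV]] := sep A B x Ax Bx.
  exists (U, V) => /=; first by rewrite !inE.
  by split => //; apply/eqP.
have [[x [Bx Ax]]|nBA] := pselect (exists x, cset B x /\ ~ cset A x).
  have [[U V] /= [UB VA oU oV UV]] := sep B A x Bx Ax.
  exists (V, U) => /=; first by rewrite !inE.
  by split => //; rewrite setIC; apply/eqP.
exfalso; move/eqP: AB; apply; apply: closedSet_inj; apply/seteqP; split => x hx.
  by apply: contrapT => h; apply: nAB; exists x.
by apply: contrapT => h; apply: nBA; exists x.
Qed.

(** A countable subbase: hitting a member of a countable base that has compact
    closure, or missing its closure. *)
Lemma fell_second_countable : hausdorff_space T ->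
  @second_countable T -> @second_countable (closedSet T).
Proof.
move=> hT [B cB [Bo Bb]].
have [b Bb'] := countable_sub_range cB.
(* The enumeration b may list sets outside the base, so being open is required
   as well as having a compact closure. *)
pose good i := open (b i) /\ compact (closure (b i)).
pose Ub i := [set x | good i /\ b i x].
have Ubg i : good i -> Ub i = b i by move=> gi; apply/seteqP; split => [x []|x].
have Ubn i : ~ good i -> Ub i = set0 by move=> gi; rewrite -subset0 => x [].
have cUb i : compact (closure (Ub i)).
  have [gi|gi] := pselect (good i); first by rewrite Ubg//; exact: gi.2.
  by rewrite Ubn// closure0; exact: compact0.
have oUb i : open (Ub i).
  have [gi|gi] := pselect (good i); first by rewrite Ubg//; exact: gi.1.
  by rewrite Ubn//; exact: open0.
have basic x U : nbhs x U -> exists i, Ub i x /\ closure (Ub i) `<=` U.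
  move=> /T_lc[K [cK nK KU]]; have [V [BV Vx] VK] := Bb x K nK.
  have [i _ bi] := Bb' _ BV; exists i.
  have clVK : closure V `<=` K.
    have /closure_id -> : closed K by exact: compact_closed.
    exact: closureS.
  rewrite Ubg ?bi; first by split => //; exact: subset_trans KU.
  rewrite /good bi; split; first exact: Bo.
  by apply: subclosed_compact cK clVK; exact: closed_closure.
pose sub (p : bool * nat) : set (closedSet T) :=
  if p.1 then hits (Ub p.2) else misses (closure (Ub p.2)).
pose W (r : seq (bool * nat)) := [set C | forall p, p \in r -> sub p C].
have refine i C : fell_index i -> fell_subbase i C ->
    exists r, W r C /\ W r `<=` fell_subbase i.
  case: i => -[] S /= hS.
    move=> [x [Cx Sx]].
    have [i [bx bS]] := basic x S (open_nbhs_nbhs (conj hS Sx)).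
    exists [:: (true, i)]; split.
      by move=> p; rewrite inE => /eqP ->; exists x.
    move=> C' /(_ _ (mem_head _ _)) [y [Cy Uy]].
    by exists y; split => //; apply: bS; exact: subset_closure.
  move=> CS; move/compact_near_coveringP : hS => hS.
  (* Finitely many good sets with closure away from C cover the compact set S:
   their indices are bounded by some n. *)
  pose P n x := exists i, [/\ (i <= n)%N, Ub i x & C `&` closure (Ub i) = set0].
  have : \forall n \near \oo, S `<=` P n.
    apply: (hS _ \oo P) => x Sx.
    have nCx : nbhs x (~` C).
      apply: open_nbhs_nbhs; split; first exact/closed_openC/cset_closed.
      by move=> Cx; have : (C `&` S) x by []; rewrite CS.
    have [i [bx KC]] := basic x _ nCx.
    exists (Ub i, [set n | (i <= n)%N]) => /=.
      by split; [exact: open_nbhs_nbhs|exists i].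
    move=> [y n] /= [byy ni]; exists i; split => //.
    by rewrite -subset0 => z [Cz /KC].
  move=> [n _ /(_ n (leqnn n)) Sn].
  pose r := [seq (false, i) | i <- iota 0 n.+1
                            & `[< C `&` closure (Ub i) = set0 >]].
  exists r; split.
    by move=> p /mapP[i]; rewrite mem_filter => /andP[/asboolP ? _] ->.
  move=> C' WC'; rewrite /fell_subbase /= -subset0 => x [C'x Sx].
  have [i [ni bx CK]] := Sn x Sx.
  have /WC' : (false, i) \in r.
    apply/mapP; exists i => //; rewrite mem_filter mem_iota add0n ltnS ni leq0n.
    by rewrite !andbT; apply/asboolP.
  rewrite /sub /misses /= -subset0 => /(_ x); apply; split => //.
  exact: subset_closure.
have sub_open p : open (sub p).
  case: p => -[] i; [exact: fell_open_hit|exact: fell_open_miss].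
have W_open r : open (W r).
  elim: r => [|p r IH].
    rewrite (_ : W [::] = setT); first exact: openT.
    by apply/seteqP; split => // C _ p; rewrite in_nil.
  rewrite (_ : W (p :: r) = sub p `&` W r); first exact: openI.
  apply/seteqP; split => [C WC|C [pC rC] q]; last first.
    by rewrite inE => /orP[/eqP ->|/rC].
  split; first exact/WC/mem_head.
  by move=> q qr; apply: WC; rewrite inE qr orbT.
have W_cat r r' : W (r ++ r') `<=` W r `&` W r'.
  by move=> C WC; split => p pr; apply: WC; rewrite mem_cat pr ?orbT.
exists (range W).
  by exact: sub_countable (card_image_le _ _) (countableP _).
split; first by move=> _ [r _ <-].
move=> C O /=; rewrite nbhsE => -[Q [oQ QC] QO].
have [s [sC sQ]] := fell_basis oQ QC.
have [r [rC rs]] : exists r, W r C /\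
    W r `<=` [set C' | forall i, i \in s -> fell_subbase i C'].
  elim: s {sQ} sC => [_|i s IH sC]; first by exists [::]; split.
  have [iD iC] := sC i (mem_head _ _).
  have [r [rC ri]] := refine i C iD iC.
  have [j js|r' [rC' rs]] := IH; first by apply: sC; rewrite inE js orbT.
  exists (r ++ r'); split.
    by move=> p; rewrite mem_cat => /orP[/rC|/rC'].
  move=> C' /W_cat[/ri iC' /rs sC'] j.
  by rewrite inE => /orP[/eqP ->|/sC'].
exists (W r); first by split => //; exists r.
by move=> C' /rs /sQ /QO.
Qed.

End FellTopology.

Section FellAction.
Context (G : topologicalGroupType).
Hypothesis G_lc : compact_nbhs_basis G.

(** For the sets missing a compact S, each x in S has g^-1 x in a compact
    neighbourhood that A misses; missing it is an open condition on A, and near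
    coverings of compact sets make the choice uniform over S. *)
Lemma translate_continuous2 :
  continuous (fun p : G * closedSet G => translate p.1 p.2).
Proof.
move=> [g A]; apply: fell_cvg => -[[] S] /= hS.
  move=> [_ [[a Aa <-] Sga]].
  have := @mulg_continuous G (g, a) S (open_nbhs_nbhs (conj hS Sga)).
  move=> [[V W] /= [nV nW] VW].
  exists (V, hits W°) => /=.
    split => //; apply: open_nbhs_nbhs; split.
      by apply: fell_open_hit; exact: open_interior.
    by exists a; split.
  move=> [h C] /= [Vh [b [Cb Wb]]]; exists (h * b)%g; split; first by exists b.
  by apply: (VW (h, b)); split => //; exact: interior_subset.
move=> AS; move/compact_near_coveringP : hS => hS.
have : \forall p \near (g, A), S `<=` (fun x => ~ (cset p.2 (p.1^-1 * x)%g)).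
  apply: (hS _ (nbhs (g, A)) (fun p x => ~ (cset p.2 (p.1^-1 * x)%g))) => x Sx.
  have nA : nbhs (g^-1 * x)%g (~` A).
    apply: open_nbhs_nbhs; split; first exact/closed_openC/cset_closed.
    move=> Agx; have : (ltrans g A `&` S) x.
      by split => //; rewrite ltransE.
    by rewrite [X in X x]AS.
  have [K [cK nK KA]] := G_lc nA.
  have cont : continuous (fun p : G * G => (p.1^-1 * p.2)%g).
    move=> p; apply: (@continuous_comp _ _ _ (fun p : G * G => (p.1^-1, p.2)%g)
      (fun q : G * G => (q.1 * q.2)%g)); last exact: mulg_continuous.
    apply: cvg_pair => /=; last exact: cvg_snd.
    by apply: continuous_comp; [exact: cvg_fst|exact: invg_continuous].
  have [[V W] /= [nV nW] VW] := cont (g, x) _ nK.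
  exists (W, V `*` misses K) => /=.
    split => //; exists (V, misses K) => //=.
    split => //; apply: open_nbhs_nbhs; split; first exact: fell_open_miss.
    by rewrite /misses /= -subset0 => y [Ay /KA].
  move=> [y [h C]] /= [Wy [Vh CK]] Chy.
  have : (C `&` K) (h^-1 * y)%g by split => //; apply: (VW (h, y)).
  by rewrite CK.
apply: filterS => -[h C] /= SC; rewrite /fell_subbase /= -subset0 => x.
by rewrite ltransE => -[Cx /SC]; exact.
Qed.

Lemma orbit_continuous (A : closedSet G) :
  continuous (fun g : G => translate g A).
Proof.
move=> g; apply: (@continuous_comp _ _ _ (fun g : G => (g, A))
  (fun p : G * closedSet G => translate p.1 p.2)); last first.
  exact: translate_continuous2.
move=> U [[V W] /= [nV nW] VW]; apply: filterS nV => h Vh.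
by apply: VW; split => //; exact: nbhs_singleton.
Qed.

Lemma translate1 (A : closedSet G) : translate 1%g A = A.
Proof.
apply: closedSet_inj; rewrite /= ltransE.
by apply/seteqP; split => x /=; rewrite invg1 mul1g.
Qed.

(** A uniform version, over a compact set, of continuity of the action at the
    identity: small translations do not leave a given neighbourhood. *)
Lemma compact_translate_near1 (K U : set (closedSet G)) :
  compact K -> open U -> K `<=` U ->
  \forall w \near 1%g, forall A, K A -> U (translate w^-1%g A).
Proof.
move=> /compact_near_coveringP cK oU KU.
have : \forall w \near 1%g, K `<=` (fun A => U (translate w^-1%g A)).
  apply: (cK _ (nbhs 1%g) (fun w A => U (translate w^-1%g A))) => A KA.
  have cont : continuous (fun p : closedSet G * G => translate p.2^-1%g p.1).
    move=> p; apply: (@continuous_comp _ _ _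
      (fun p : closedSet G * G => (p.2^-1%g, p.1))
      (fun p : G * closedSet G => translate p.1 p.2)); last first.
      exact: translate_continuous2.
    move=> O [[V W] /= [nV nW] VW].
    exists (W, (fun g : G => g^-1%g) @^-1` V) => /=.
      by split => //; exact: invg_continuous.
    by move=> [B h] /= [WB Vh]; exact: (VW (h^-1%g, B)).
  apply: (cont (A, 1%g)); apply: open_nbhs_nbhs; split => //=.
  by rewrite invg1 translate1; exact: KU.
by [].
Qed.

End FellAction.

(** * Geometry of a homogeneous metric *)
Section FiniteSubcover.

(** Compactness applied to the filter of large finite lists of centres. *)
Lemma compact_seq_cover (T : topologicalType) (K : set T) (U : T -> set T) :
  compact K -> (forall x, K x -> nbhs x (U x)) ->
  exists s : seq T, K `<=` [set y | exists2 x, x \in s & U x y].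
Proof.
move=> /compact_near_coveringP cK nU.
pose F := [set P : set (seq T) |
  exists s0 : seq T, forall s, {subset s0 <= s} -> P s].
have FF : Filter F.
  split; first by exists [::].
    move=> P Q [s Ps] [r Qr]; exists (s ++ r) => q sq; split.
      by apply: Ps => x xs; apply: sq; rewrite mem_cat xs.
    by apply: Qr => x xr; apply: sq; rewrite mem_cat xr orbT.
  by move=> P Q PQ [s Ps]; exists s => r /Ps /PQ.
have [s Ks] : F [set s : seq T | K `<=` [set y | exists2 x, x \in s & U x y]].
  apply: (cK _ F (fun (s : seq T) y => exists2 x, x \in s & U x y)) => x Kx.
  exists (U x, [set s : seq T | x \in s]) => /=.
    split; first exact: nU.
    by exists [:: x] => s; apply; exact: mem_head.
  by move=> [y s] /= [Uxy xs]; exists x.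
by exists s; exact: Ks.
Qed.

Lemma matching_size (T U : eqType) (s : seq T) (t : seq U) (f : T -> U) :
  uniq s -> {in s &, injective f} -> (forall x, x \in s -> f x \in t) ->
  (size s <= size t)%N.
Proof.
move=> us inj fst; rewrite -(size_map f); apply: uniq_leq_size.
  by rewrite map_inj_in_uniq.
by move=> _ /mapP[x xs ->]; exact: fst.
Qed.

End FiniteSubcover.

Section Geometry.
Context (R : realType) (n : nat) (G : lieGroupType R n)
  (D : homogeneousStructure G) (d : homogeneousMetric D).
Implicit Types (x y z g h : G) (t e : R).

Definition cball t g := [set h | d h g <= t].

Lemma hdistxx x : d x x = 0.
Proof. exact: (hdist_eq0 d x x).2. Qed.

Lemma nbhs_hball t g : 0 < t -> nbhs g (hball d t g).
Proof. by move=> t0; apply/(hdist_nbhs d); exists t. Qed.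

Lemma hdist_openP (U : set G) : open U <->
  forall x, U x -> exists2 e, 0 < e & hball d e x `<=` U.
Proof.
split=> [oU x Ux|h].
  exact/(hdist_nbhs d)/open_nbhs_nbhs.
by rewrite openE => x /h; move/(hdist_nbhs d).
Qed.

Lemma open_hball t g : open (hball d t g).
Proof.
apply/hdist_openP => x; rewrite /hball /= => xg.
exists (t - d x g); first by rewrite subr_gt0.
move=> y; rewrite /hball /= ltrBrDr; exact/le_lt_trans/hdist_triangle.
Qed.

Lemma closed_cball t g : closed (cball t g).
Proof.
rewrite -[cball _ _]setCK; apply: open_closedC; apply/hdist_openP => x /=.
move=> /negP; rewrite -ltNge => xg.
exists (d x g - t); first by rewrite subr_gt0.
move=> y; rewrite /hball /= => yx; apply/negP; rewrite -ltNge.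
have := hdist_triangle d x y g; rewrite (hdistC d x y) => h.
by move: yx h; set a := d y x; set b := d x g; set c := d y g => *; lra.
Qed.

Lemma hball_cball t g : hball d t g `<=` cball t g.
Proof. by move=> x; exact: ltW. Qed.

Lemma hdist_mul2l g x y : d (g * x)%g (g * y)%g = d x y.
Proof. exact: hdist_left_invariant. Qed.

Lemma hdist_mulVl g x y : d (g^-1 * x)%g y = d x (g * y)%g.
Proof. by rewrite -(hdist_mul2l g) mulVKg. Qed.

Lemma hdist_inv x : d x^-1%g 1%g = d x 1%g.
Proof. by rewrite -(hdist_mul2l x) mulgV mulg1 hdistC. Qed.

Lemma dilation1 t : 0 < t -> dilation D t 1%g = 1%g.
Proof.
move=> t0; have [mD _] := dilation_aut D t0.
by apply: (@mulgI G (dilation D t 1%g)); rewrite -mD !mulg1.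
Qed.

Lemma dilation_norm t x : 0 < t -> d (dilation D t x) 1%g = t * d x 1%g.
Proof. by move=> t0; rewrite -{1}(dilation1 t0) hdist_dilation. Qed.

Lemma dilation_surj t y : 0 < t -> exists x, dilation D t x = y.
Proof.
move=> t0; have [_ [psi [_ psiK _ _]]] := dilation_aut D t0.
by exists (psi y).
Qed.

Lemma dilation_continuous t : 0 < t -> continuous (dilation D t).
Proof. by move=> t0; have [_ [psi [_ _ []]]] := dilation_aut D t0. Qed.

Lemma vector_nbhs_compact (p : 'rV[R]_n) (O : set 'rV[R]_n) : nbhs p O ->
  exists K, [/\ compact K, nbhs p K & K `<=` O].
Proof.
move=> /nbhs_ballP[e /= e0 eO].
have e20 : 0 < e / 2 by rewrite divr_gt0.
exists (closed_ball_ Num.norm p (e / 2)); split.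
- apply: bounded_closed_compact; last exact: closed_closed_ball_.
  exists (`|p| + e / 2); split; first exact: num_real.
  move=> M pM y /= py; apply/ltW/(le_lt_trans _ pM).
  rewrite -[y](subrK p) addrC (le_trans (ler_normD _ _))// lerD2l.
  by rewrite distrC.
- apply/nbhs_ballP; exists (e / 2) => //= y; rewrite -ball_normE /=.
  exact: ltW.
- move=> y /= py; apply: eO; rewrite -ball_normE /=.
  by rewrite (le_lt_trans py)// gtr_pMr// invf_lt1// ltr1n.
Qed.

(** Local compactness is inherited from the model vector space through a chart
    around the identity. *)
Lemma chart_nbhs_compact : exists2 K : set G, compact K & nbhs 1%g K.
Proof.
have [c _ c1] := @atlas_cover R n G 1%g.
have od := @dom_open _ _ _ c; have oc := @coord_open _ _ _ c.
have pO : nbhs (Defs.coord c 1%g) (Defs.coord c @` dom c).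
  by apply: open_nbhs_nbhs; split => //; exists 1%g.
have [K [cK nK KO]] := vector_nbhs_compact pO.
exists (param c @` K).
  apply: continuous_compact cK; apply: continuous_subspaceW KO _.
  exact: param_continuous.
have /subspace_continuousP/(_ 1%g c1) hc := @Defs.coord_continuous _ _ _ c.
have := hc _ nK; rewrite /nbhs /= /within /=.
have nd : nbhs (1%g : G) (dom c) by apply: open_nbhs_nbhs.
move=> h; apply: (@filterS _ (nbhs (1%g : G)) _ _ _ _ (filterI nd h)).
move=> x /= [dx /(_ dx) Kx].
by exists (Defs.coord c x) => //; rewrite Defs.coordK// inE.
Qed.

(** Small closed balls at the identity are compact; dilations and left
    translations carry them onto all closed balls. *)
Lemma compact_cball t g : compact (cball t g).
Proof.
have [K cK /(hdist_nbhs d)[e e0 eK]] := chart_nbhs_compact.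
have e20 : 0 < e / 2 by rewrite divr_gt0.
have ce : compact (cball (e / 2) 1%g).
  apply: subclosed_compact cK _; first exact: closed_cball.
  move=> x xe; apply: eK => /=; apply: (le_lt_trans xe).
  by rewrite gtr_pMr// invf_lt1// ltr1n.
have [t0|t0] := leP t 0.
  apply: (subclosed_compact _ (@compact_set1 _ g)); first exact: closed_cball.
  move=> x xg; apply/(hdist_eq0 d)/le_anti; rewrite hdist_ge0 andbT.
  exact: le_trans t0.
have l0 : 0 < t / (e / 2) by rewrite divr_gt0.
have cf : continuous (fun x => (g * dilation D (t / (e / 2)) x)%g).
  move=> x; apply: (@continuous_comp _ _ _ (dilation D (t / (e / 2)))
    (fun x => (g * x)%g)); first exact: dilation_continuous.
  exact: mulg_left_continuous.
apply: (subclosed_compact _ (continuous_compact (continuous_subspaceT cf) ce)).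
  exact: closed_cball.
move=> x xg; have [y yE] := dilation_surj (g^-1 * x)%g l0.
exists y; last by rewrite yE mulVKg.
rewrite /cball /= -(ler_pM2l l0) -dilation_norm// yE hdist_mulVl mulg1.
by rewrite divfK// gt_eqF.
Qed.

Lemma G_compact_nbhs_basis : compact_nbhs_basis G.
Proof.
move=> x U /(hdist_nbhs d)[e e0 eU]; exists (cball (e / 2) x); split.
- exact: compact_cball.
- apply: filterS (@hball_cball _ _) _; apply: nbhs_hball; exact: divr_gt0.
- move=> y yx; apply: eU => /=; apply: (le_lt_trans yx).
  by rewrite gtr_pMr// invf_lt1// ltr1n.
Qed.

Lemma compact_hball (K : set G) :
  compact K -> exists t : nat, K `<=` hball d t%:R 1%g.
Proof.
move=> /compact_near_coveringP cK.
pose P (t : nat) (x : G) := d x 1%g < t%:R.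
suff [t _ /(_ t (leqnn t))] : \forall t \near \oo, K `<=` P t by exists t.
apply: (cK _ \oo P) => x Kx.
have [N xN] : exists N : nat, d x 1%g + 1 <= N%:R.
  by exists (Num.truncn (d x 1%g + 1)).+1; exact/ltW/truncnS_gt.
exists (hball d 1 x, [set t | (N <= t)%N]) => /=.
  by split; [exact: nbhs_hball|exists N].
move=> [y t] /= [yx Nt]; rewrite /P /=.
rewrite (le_lt_trans (hdist_triangle d y x 1%g))//.
have : N%:R <= t%:R :> R by rewrite ler_nat.
by move: yx; rewrite /hball /=; move: (d y x) (d x 1%g) xN => a b *; lra.
Qed.

Definition covered e (S : set G) (s : seq G) :=
  S `<=` [set x | exists2 y, y \in s & d x y < e].

(** The covering constant depends only on the ratio of the two radii: a cover at
    scale 1 is carried to scale t by a dilation. *)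
Lemma hball_cover a b : 0 < a -> 0 < b -> exists N : nat, forall t, 0 < t ->
  exists2 s, (size s <= N)%N & covered (b * t) (hball d (a * t) 1%g) s.
Proof.
move=> a0 b0.
have ca : compact (cball a 1%g) by exact: compact_cball.
have [s Ks] := compact_seq_cover ca
  (fun x _ => nbhs_hball x b0).
exists (size s) => t t0.
exists (map (dilation D t) s); first by rewrite size_map.
move=> x; have [y <-] := dilation_surj x t0; rewrite /hball /= dilation_norm//.
rewrite mulrC ltr_pM2r// => ya; have [z zs yz] := Ks y (ltW ya).
exists (dilation D t z); first exact: map_f.
by rewrite hdist_dilation// mulrC ltr_pM2r.
Qed.

Lemma hball_seq_cover a b : 0 < b -> exists s, covered b (hball d a 1%g) s.
Proof.
move=> b0; have ca : compact (cball a 1%g) by exact: compact_cball.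
have [s Ks] := compact_seq_cover ca
  (fun x _ => nbhs_hball x b0).
by exists s => x /ltW /Ks[y ys xy]; exists y.
Qed.

Definition separated e (s : seq G) :=
  forall x y, x \in s -> y \in s -> x != y -> e <= d x y.

(** A ball of radius e / 2 contains at most one point of an e-separated list. *)
Lemma separated_covered_size e (s t : seq G) : uniq s -> separated e s ->
  covered (e / 2) [set` s] t -> (size s <= size t)%N.
Proof.
move=> us ss st; have /choice[f fP] : forall x, exists y, x \in s ->
    y \in t /\ d x y < e / 2.
  move=> x; have [xs|_] := boolP (x \in s); last by exists x.
  by have [y yt xy] := st x xs; exists y.
apply: (@matching_size _ _ _ _ f) => // [x y xs ys fxy|x xs]; last first.
  by have [] := fP x xs.
apply/eqP/negPn/negP => xy; have := ss x y xs ys xy.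
have [_ xf] := fP x xs; have [_ yf] := fP y ys; apply/negP; rewrite -ltNge.
apply: (le_lt_trans (hdist_triangle d x (f x) y)).
by rewrite [ltRHS]splitr ltrD// fxy hdistC.
Qed.

(** Sizes of separated lists in a ball are bounded, so one of maximal size
    exists, and maximality makes it a net. *)
Lemma maximal_separated e a : 0 < e -> 0 < a -> exists s : seq G,
  [/\ uniq s, separated e s, 1%g \in s, {subset s <= hball d a 1%g} &
      covered e (hball d a 1%g) s].
Proof.
move=> e0 a0; have [t ht] := hball_seq_cover a (divr_gt0 e0 (ltr0Sn R 1)).
pose good s :=
  [/\ uniq s, separated e s, 1%g \in s & {subset s <= hball d a 1%g}].
pose P k := `[< exists2 s, good s & size s = k >].
have exP : exists k, P k.
  exists 1%N; apply/asboolP; exists [:: 1%g] => //; split => //.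
  - by move=> x y; rewrite !inE => /eqP -> /eqP ->; rewrite eqxx.
  - by rewrite inE.
  - by move=> x; rewrite !inE => /eqP ->; rewrite /hball /= hdistxx.
have Pb k : P k -> (k <= size t)%N.
  move=> /asboolP[s [us ss _ sa] <-]; apply: separated_covered_size us ss _.
  by move=> x /= /sa; rewrite inE => /ht.
case: (ex_maxnP exP Pb) => k /asboolP[s [us ss s1 sa] sk] kmax.
exists s; split => // x xa; apply: contrapT => nx.
have far y : y \in s -> e <= d x y.
  by move=> ys; rewrite leNgt; apply/negP => xy; apply: nx; exists y.
have xs : x \notin s.
  by apply/negP => /far; rewrite hdistxx leNgt e0.
have /kmax : P k.+1.
  apply/asboolP; exists (x :: s); last by rewrite /= sk.
  split; rewrite ?inE ?s1 ?orbT//=; first by rewrite xs.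
    move=> y z; rewrite !inE => /orP[/eqP ->|ys] /orP[/eqP ->|zs].
    - by rewrite eqxx.
    - by move=> _; exact: far.
    - by move=> _; rewrite hdistC; exact: far.
    - exact: ss.
  by move=> y; rewrite !inE => /orP[/eqP -> //|/sa]; rewrite inE.
by rewrite ltnn.
Qed.

End Geometry.

(** * Counting visits with linear repetitivity *)
Section PatternCounting.
Context (R : realType) (n : nat) (G : lieGroupType R n)
  (D : homogeneousStructure G) (d : homogeneousMetric D).

Definition local_set (s : R) (W : set (closedSet G)) := forall A B, W A ->
  (forall z, d z 1%g < s -> cset A z <-> cset B z) -> W B.

Lemma local_setW s t W : s <= t -> local_set s W -> local_set t W.
Proof.
move=> st lW A B WA AB; apply: (lW A) => // z zs.
by apply: AB; exact: lt_le_trans st.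
Qed.

(** Hitting U can be witnessed inside a ball, and a compact set to be missed
    lies in a ball. *)
Lemma local_refine (O : set (closedSet G)) A : open O -> O A ->
  exists (s : nat) W, [/\ open W, W A, W `<=` O & local_set s%:R W].
Proof.
move=> oO OA; have [r [rA rO]] := fell_basis oO OA.
suff [s [W [oW WA Wr lW]]] : exists (s : nat) W, [/\ open W, W A,
    W `<=` [set B | forall i, i \in r -> fell_subbase i B] & local_set s%:R W].
  by exists s, W; split => // B /Wr; exact: rO.
elim: r rA {rO} => [_|i r IH rA].
  by exists 0%N, setT; split => //; exact: openT.
have [s [W [oW WA Wr lW]]] :=
  IH (fun j jr => rA j (mem_behead (s := i :: r) jr)).
suff [t [V [oV VA Vi lV]]] : exists (t : nat) V, [/\ open V, V A,
    V `<=` fell_subbase i & local_set t%:R V].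
  exists (maxn s t), (W `&` V); split.
  - exact: openI.
  - by split.
  - by move=> B [/Wr WB /Vi VB] j; rewrite inE => /orP[/eqP ->|/WB].
  - move=> B B' [WB VB] BB'; split.
      by apply: (local_setW _ lW WB BB'); rewrite ler_nat leq_maxl.
    by apply: (local_setW _ lV VB BB'); rewrite ler_nat leq_maxr.
have [] := rA i (mem_head _ _); case: i {rA} => -[] S /= hS.
  move=> [x [Ax Sx]].
  have [t xt] := compact_hball d (@compact_set1 _ x).
  pose V := hits (S `&` hball d t%:R 1%g).
  exists t, V; split.
  - by apply: fell_open_hit; apply: openI => //; exact: open_hball.
  - by exists x; split => //; split => //; exact: xt.
  - by move=> C [y [Cy [Sy _]]]; exists y.
  - by move=> B C [y [By [Sy yt]]] BC; exists y; split => //; exact/BC.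
move=> AS; have [t St] := compact_hball d hS.
exists t, (misses S); split => //.
  exact: fell_open_miss.
move=> B C BS BC; rewrite /misses /= -subset0 => y [Cy Sy].
have : (B `&` S) y by split => //; apply/BC => //; exact: St.
by rewrite [X in X y]BS.
Qed.

Lemma compact_local_nbhs (K U : set (closedSet G)) : compact K -> open U ->
  K `<=` U ->
  exists (s : nat) V, [/\ open V, K `<=` V, V `<=` U & local_set s%:R V].
Proof.
move=> /compact_near_coveringP cK oU KU.
pose V (s : nat) :=
  [set A | exists W, [/\ open W, W A, W `<=` U & local_set s%:R W]].
have [s _ /(_ s (leqnn s)) Ks] : \forall s \near \oo, K `<=` V s.
  apply: (cK _ \oo V) => A KA.
  have [s [W [oW WA WU lW]]] := local_refine oU (KU A KA).
  exists (W, [set t | (s <= t)%N]) => /=.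
    by split; [exact: open_nbhs_nbhs|exists s].
  move=> [B t] /= [WB st]; exists W; split => //.
  by apply: local_setW lW; rewrite ler_nat.
exists s, (V s); split => //.
- rewrite openE => A [W [oW WA WU lW]].
  apply: (@filterS _ (nbhs A) _ W); last exact: open_nbhs_nbhs.
  by move=> B WB; exists W.
- by move=> A [W [_ WA WU _]]; exact: WU.
- by move=> A B [W [oW WA WU lW]] AB; exists W; split => //; exact: lW AB.
Qed.

Variable C : closedSet G.

Lemma hull_approx (x : closedSet G) (P : set (closedSet G)) :
  hull C x -> nbhs x P -> exists h, P (translate h C).
Proof. by move=> hx /hx[_ [[h _ <-] Ph]]; exists h. Qed.

Lemma near_forall_seq (T : topologicalType) (I : eqType) (s : seq I) (x : T)
    (P : I -> set T) : (forall i, i \in s -> nbhs x (P i)) ->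
  nbhs x [set y | forall i, i \in s -> P i y].
Proof.
elim: s => [_|i s IH nP].
  by apply: (@nearW _ (nbhs x)) => y i; rewrite in_nil.
have nPs : nbhs x (P i `&` [set y | forall j, j \in s -> P j y]).
  apply: filterI; first exact/nP/mem_head.
  by apply: IH => j js; apply: nP; rewrite inE js orbT.
apply: (@filterS _ (nbhs x) _ _ _ _ nPs) => y [Pi Ps] j.
by rewrite inE => /orP[/eqP ->|/Ps].
Qed.

Definition visits (K : set (closedSet G)) (x : closedSet G) (s : seq G) :=
  count (fun u => `[< K (translate u^-1%g x) >]) s.

Lemma le_visits K K' x x' s : (forall u, u \in s ->
    K (translate u^-1%g x) -> K' (translate u^-1%g x')) ->
  (visits K x s <= visits K' x' s)%N.
Proof.
rewrite /visits; elim: s => //= u s IH h; apply: leq_add; last first.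
  by apply: IH => v vs; apply: h; rewrite inE vs orbT.
have := h u (mem_head _ _).
by case: asboolP => // Ku /(_ Ku) K'u; case: asboolP.
Qed.

(** Counting visits to an open set is lower semicontinuous and to a closed set
    upper semicontinuous, so a comparison between points of the orbit extends to
    the hull at the price of enlarging the two sets a little. *)
Lemma visits_hull K V U' U s t : open V -> K `<=` V -> closure U' `<=` U ->
  (forall h k, (visits V (translate h C) s <= visits U' (translate k C) t)%N) ->
  forall x y, hull C x -> hull C y -> (visits K x s <= visits U y t)%N.
Proof.
move=> oV KV U'U le x y hx hy.
have [h hh] : exists h, forall u, u \in s -> K (translate u^-1%g x) ->
    V (translate u^-1%g (translate h C)).
  pose P u : set (closedSet G) :=
    [set x' | K (translate u^-1%g x) -> V (translate u^-1%g x')].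
  apply: (@hull_approx _ [set x' | forall u, u \in s -> P u x'] hx).
  apply: (@near_forall_seq (closedSet G) _ _ _ P) => u us.
  have [Kx|nKx] := pselect (K (translate u^-1%g x)); last first.
    by apply: (@nearW _ (nbhs x)) => x' /nKx.
  have Vx := open_nbhs_nbhs (conj oV (KV _ Kx)).
  have nV := @translate_continuous G u^-1%g x V Vx.
  by apply: (@filterS _ (nbhs x) _ _ _ _ nV) => x' Vx' _.
have [k kk] : exists k, forall v, v \in t ->
    U' (translate v^-1%g (translate k C)) -> U (translate v^-1%g y).
  pose P v : set (closedSet G) :=
    [set y' | U' (translate v^-1%g y') -> U (translate v^-1%g y)].
  apply: (@hull_approx _ [set y' | forall v, v \in t -> P v y'] hy).
  apply: (@near_forall_seq (closedSet G) _ _ _ P) => v vt.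
  have [Uy|nUy] := pselect (U (translate v^-1%g y)).
    by apply: (@nearW _ (nbhs y)) => y' _.
  have nb : nbhs (translate v^-1%g y) (~` closure U').
    apply: open_nbhs_nbhs; split; first exact/closed_openC/closed_closure.
    by move=> /U'U.
  have nV := @translate_continuous G v^-1%g y _ nb.
  by apply: (@filterS _ (nbhs y) _ _ _ _ nV) => y' /= ny' /subset_closure /ny'.
apply: (leq_trans (le_visits hh)); apply: (leq_trans (le h k)).
exact: le_visits kk.
Qed.

Hypothesis C_rep : linearly_repetitive d C.

(** The nets s and s' are separated at mesh 3 e and e in balls of radius t / 2
    and c t. Repetitivity moves s by a translation into the large ball, and
    each moved point is within e of a point of s'; since 2 e < 3 e these points
    of s' are distinct. The displacement by less than e is absorbed by passing
    from V2 to U'. *)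
Theorem pattern_counting : exists2 delta : R, 0 < delta < 1 &
  forall K U : set (closedSet G), closed K -> open U -> K `<=` U ->
  exists s t : seq G, [/\ 1%g \in s, (0 < size t)%N,
    delta * (size t)%:R <= (size s)%:R &
    forall x y, hull C x -> hull C y -> (visits K x s <= visits U y t)%N].
Proof.
have [c c1 rep] := C_rep; have c0 : 0 < c by rewrite (lt_le_trans ltr01).
have [N1 cov1] := hball_cover d c0 (divr_gt0 ltr01 (ltr0Sn R 1)).
have [N2 cov2] := hball_cover d (ltr0Sn R 2) (divr_gt0 ltr01 (ltr0Sn R 1)).
exists ((N1 * N2)%:R + 2)^-1.
  have := ler0n R (N1 * N2).
  move: (_%:R) => z z0; rewrite invr_gt0 invf_lt1; last by lra.
  by apply/andP; split; lra.
move=> K U cK oU KU.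
have Xh := fell_hausdorff (G_compact_nbhs_basis d).
have Xc := @fell_compact G.
have normal := compact_normal Xh Xc.
have shrink (F O : set (closedSet G)) : closed F -> open O -> F `<=` O ->
    exists V, [/\ open V, F `<=` V & closure V `<=` O].
  move=> cF oO FO; have /(normal F cF) : set_nbhs F O.
    by apply/set_nbhsP; exists O; split.
  move=> [W /set_nbhsP[V [oV FV VW]] WO]; exists V; split => //.
  exact: subset_trans (closureS VW) WO.
have [U' [oU' KU' U'U]] := shrink _ _ cK oU KU.
have [V2 [oV2 KV2 V2U']] := shrink _ _ cK oU' KU'.
have cpK : compact K by apply: (subclosed_compact cK Xc).
have [r [V [oV KV VV2 lV]]] := compact_local_nbhs cpK oV2 KV2.
have cpV2 : compact (closure V2).
  by apply: (subclosed_compact _ Xc) => //; exact: closed_closure.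
have := compact_translate_near1 (G_compact_nbhs_basis d) cpV2 oU' V2U'.
move=> /(hdist_nbhs d)[e e0 eU'].
(* The radius t is at least 1, as repetitivity requires, and patterns of radius
   r around points of the ball of radius t / 2 stay in that of radius t. *)
pose t : R := 2 * r%:R + 1.
have r0 := ler0n R r.
have t1 : 1 <= t by rewrite /t; lra.
have t0 : 0 < t by rewrite /t; lra.
have rt : r%:R <= t / 2 by rewrite /t; lra.
have e30 : 0 < 3 * e by lra.
have t20 : 0 < t / 2 by lra.
have ct0 : 0 < c * t by rewrite mulr_gt0.
have [s [us ss s1 sb sc]] := maximal_separated d e30 t20.
have [s' [us' ss' s'1 s'b s'c]] := maximal_separated d e0 ct0.
exists s, s'; split => //.
- by case: (s') s'1.
(* The large ball is covered by at most N1 balls of radius t / 2, each of these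
   by the balls of radius 3 e around a translate of s, and each of the latter by
   at most N2 balls of radius e / 2, which contain at most one point of s'. *)
- have [h1 sz1 hc1] := cov1 _ t0; have [h2 sz2 hc2] := cov2 _ e0.
  rewrite mulrC ler_pdivrMr; last first.
    by have := ler0n R (N1 * N2); lra.
  apply: (@le_trans _ _ ((N1 * N2)%:R * (size s)%:R)); last first.
    by rewrite mulrC ler_wpM2l// lerDl.
  rewrite -natrM ler_nat.
  pose q := [seq (x * w)%g | x <- [seq (h * u)%g | h <- h1, u <- s], w <- h2].
  have sq : (size q <= N1 * N2 * size s)%N.
    by rewrite !size_allpairs mulnAC leq_mul2r leq_mul ?orbT.
  apply: leq_trans sq; apply: (separated_covered_size us' ss').
  move=> v /= /s'b; rewrite inE => /hc1[h hh1 vh].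
  have : hball d (t / 2) 1%g (h^-1 * v)%g.
    by rewrite /hball /= hdist_mulVl mulg1 (lt_le_trans vh)//; lra.
  move=> /sc[u us_ hu].
  have : hball d (3 * e) 1%g ((h * u)^-1 * v)%g.
    by rewrite /hball /= hdist_mulVl mulg1 -hdist_mulVl.
  move=> /hc2[w wh2 wu].
  exists (h * u * w)%g.
    by apply/allpairsP; exists ((h * u)%g, w) => /=; split => //;
      apply/allpairsP; exists (h, u).
  by rewrite -hdist_mulVl (lt_le_trans wu)//; lra.
apply: (visits_hull oV KV U'U) => h k.
have [g [gsub gC]] := rep t t1 h^-1%g k^-1%g.
have agree p : d p h^-1%g < t -> cset C p <-> cset C (g * p)%g.
  move=> pt; have gp : ltrans g (hball d t h^-1%g) (g * p)%g by exists p.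
  split=> [Cp|Cgp].
    have : ltrans g (C `&` hball d t h^-1%g) (g * p)%g by exists p.
    by rewrite gC => -[].
  have : (C `&` ltrans g (hball d t h^-1%g)) (g * p)%g by [].
  by rewrite -gC => -[p' [Cp' _] /mulgI <-].
(* The translation that moves the trace of h C on the ball of radius t to the
   corresponding trace of k C. *)
pose f0 u := (k * g * h^-1 * u)%g.
have normu u z : u \in s -> d z 1%g < r%:R -> d (h^-1 * u * z)%g h^-1%g < t.
  move=> /sb; rewrite inE /hball /= => ut zr.
  rewrite -mulgA -[X in d _ X]mulg1 hdist_mul2l.
  apply: (le_lt_trans (hdist_triangle d _ (u * 1)%g _)).
  by rewrite hdist_mul2l mulg1; lra.
have near u : u \in s -> exists2 v, v \in s' & d v (f0 u) < e.
  move=> us_; have : hball d (c * t) 1%g (f0 u).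
    have hu : hball d t h^-1%g (h^-1 * u)%g.
      have := normu u 1%g us_; rewrite mulg1 => h'; rewrite /hball /=.
      move: us_ => /sb; rewrite inE /hball /= => ut.
      rewrite -[X in d _ X]mulg1 hdist_mul2l; lra.
    have : ltrans g (hball d t h^-1%g) (g * (h^-1 * u))%g.
      by exists (h^-1 * u)%g.
    move=> /gsub; rewrite /hball /= -(hdist_mul2l d k) mulgV.
    by rewrite /f0 !mulgA.
  by move=> /s'c[v vs' vu]; exists v => //; rewrite hdistC.
have /choice[f fP] : forall u, exists v, u \in s -> v \in s' /\ d v (f0 u) < e.
  move=> u; have [/near[v vs' vu]|_] := boolP (u \in s); last by exists u.
  by exists v.
rewrite /visits -!size_filter.
apply: (@matching_size _ _ _ _ f); first exact: filter_uniq.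
  move=> u w; rewrite !mem_filter => /andP[_ us_] /andP[_ ws] fuw.
  apply/eqP/negPn/negP => uw.
  have [_] := fP u us_; rewrite fuw => fu; have [_ fw] := fP w ws.
  have := ss u w us_ ws uw; rewrite -(hdist_mul2l d (k * g * h^-1)%g).
  rewrite -/(f0 u) -/(f0 w).
  have := hdist_triangle d (f0 u) (f w) (f0 w); rewrite (hdistC d (f0 u) (f w)).
  move: fu fw; move: (d (f w) (f0 u)) (d (f w) _) (d (f0 u) _) => a b a' *; lra.
move=> u; rewrite !mem_filter => /andP[/asboolP Vu us_].
have [fs' fu] := fP u us_; rewrite fs' andbT; apply/asboolP.
pose w := ((f0 u)^-1 * f u)%g.
have wE : translate (f u)^-1%g (translate k C) =
    translate w^-1%g (translate (f0 u)^-1%g (translate k C)).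
  rewrite -[in RHS]translateM; congr (translate _ _).
  by rewrite /w -invgM mulVKg.
rewrite wE; apply: (eU' w); first by rewrite /= /w hdist_mulVl mulg1.
apply/subset_closure/VV2; apply: (lV _ _ Vu) => z zr.
rewrite -!translateM /= !ltransE /= !invgM !invgK.
have -> : (k^-1 * f0 u * z)%g = (g * (h^-1 * u * z))%g.
  by rewrite /f0 !mulgA mulVg mul1g.
exact/agree/normu.
Qed.

End PatternCounting.

(** * Ultralimits of bounded sequences *)
Section UltraLimit.
Context (R : realType).

Definition ultranat : set_system nat :=
  projT1 (cid (ultraFilterLemma (eventually_filter : ProperFilter \oo))).

Lemma ultranat_ultra : UltraFilter ultranat.
Proof. by rewrite /ultranat; case: cid => F [/=]. Qed.

Lemma ultranat_near (P : set nat) : (\forall k \near \oo, P k) -> ultranat P.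
Proof. by rewrite /ultranat; case: cid => F [/= _ h]; exact: h. Qed.

Instance ultranat_proper : ProperFilter ultranat.
Proof. exact: (@ultra_proper _ _ ultranat_ultra). Qed.

Definition ulim (u : nat -> R) : R := lim (u @ ultranat).

Definition ubounded (u : nat -> R) := exists M, forall k, `|u k| <= M.

Lemma ulim_cvg u : ubounded u -> u @ ultranat --> ulim u.
Proof.
move=> [M uM]; apply/cvg_ex.
have [|p [_ up]] := @segment_compact R (- M) M (u @ ultranat) _.
  by apply: ultranat_near; apply: nearW => k; rewrite /= in_itv /= -ler_norml.
exists p => V nV; have UU := ultranat_ultra.
have [//|nuV] := in_ultra_setVsetC (u @^-1` V) UU.
by have [x []] := up (~` V) V nuV nV.
Qed.

Lemma ulim_le u v : ubounded u -> ubounded v ->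
  (\forall k \near \oo, u k <= v k) -> ulim u <= ulim v.
Proof.
move=> bu bv uv; apply: (ler_cvg_to (ulim_cvg bu) (ulim_cvg bv)).
exact: ultranat_near.
Qed.

Lemma uboundedD u v : ubounded u -> ubounded v -> ubounded (u \+ v).
Proof.
move=> [M uM] [N vN]; exists (M + N) => k /=.
by rewrite (le_trans (ler_normD _ _))// lerD.
Qed.

Lemma ulimD u v : ubounded u -> ubounded v -> ulim (u \+ v) = ulim u + ulim v.
Proof.
move=> bu bv; apply/cvg_lim => //.
by apply: cvgD; exact: ulim_cvg.
Qed.

Lemma ulim_cst (a : R) : ulim (fun=> a) = a.
Proof. by apply/cvg_lim => //; exact: cvg_cst. Qed.

Lemma ubounded_cst (a : R) : ubounded (fun=> a).
Proof. by exists `|a|. Qed.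

End UltraLimit.

(** * A left-invariant mean from covering numbers *)
Section CoveringNumber.
Context (R : realType) (n : nat) (G : lieGroupType R n)
  (D : homogeneousStructure G) (d : homogeneousMetric D).
Implicit Types (S A B : set G) (e t : R).

Definition hbounded S := exists t, S `<=` hball d t 1%g.

Lemma hboundedS S A : S `<=` A -> hbounded A -> hbounded S.
Proof. by move=> SA [t At]; exists t; exact: subset_trans At. Qed.

Lemma hbounded_hball t : hbounded (hball d t 1%g).
Proof. by exists t. Qed.

Lemma hboundedU S A : hbounded S -> hbounded A -> hbounded (S `|` A).
Proof.
move=> [s Ss] [t At]; exists (Num.max s t) => x [/Ss|/At];
  by rewrite /hball /= lt_max => ->; rewrite ?orbT.
Qed.

Lemma hbounded_ltrans g S : hbounded S -> hbounded (ltrans g S).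
Proof.
move=> [t St]; exists (t + d g 1%g) => _ [x /St xt <-]; rewrite /hball /=.
rewrite (le_lt_trans (hdist_triangle d _ (g * 1)%g _))//.
by rewrite hdist_mul2l mulg1 ltrD2r.
Qed.

Definition covnum_pred e S k := `[< exists2 s, covered d e S s & size s = k >].

(** Bounded sets have finite covers; the value 0 is a default for the others. *)
Definition covnum e S : nat :=
  if pselect (exists k, covnum_pred e S k) is left h then ex_minn h else 0%N.

Lemma cov_le e S s : covered d e S s -> (covnum e S <= size s)%N.
Proof.
move=> Ss; have Ps : covnum_pred e S (size s) by apply/asboolP; exists s.
by rewrite /covnum; case: pselect => // h; case: ex_minnP => k _; exact.
Qed.

Lemma cov_witness e S : 0 < e -> hbounded S ->
  exists2 s, covered d e S s & size s = covnum e S.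
Proof.
move=> e0 [t St]; have [s hs] := hball_seq_cover d t e0.
have ex : exists k, covnum_pred e S k.
  by exists (size s); apply/asboolP; exists s => //; exact: subset_trans hs.
rewrite /covnum; case: pselect => // h.
by case: ex_minnP => k /asboolP.
Qed.

Lemma cov_mono e S A : 0 < e -> hbounded A -> S `<=` A ->
  (covnum e S <= covnum e A)%N.
Proof.
move=> e0 bA SA; have [s As <-] := cov_witness e0 bA; apply: cov_le.
exact: subset_trans As.
Qed.

Lemma cov_subadd e S A : 0 < e -> hbounded S -> hbounded A ->
  (covnum e (S `|` A) <= covnum e S + covnum e A)%N.
Proof.
move=> e0 bS bA; have [s Ss <-] := cov_witness e0 bS.
have [t At <-] := cov_witness e0 bA; rewrite -size_cat; apply: cov_le.
move=> x [/Ss[y ys]|/At[y yt]] xy; exists y => //.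
  by rewrite mem_cat ys.
by rewrite mem_cat yt orbT.
Qed.

(** A ball of radius e cannot meet both sets, so an optimal cover of the union
    splits into covers of each. *)
Lemma cov_sep e S A : 0 < e -> hbounded S -> hbounded A ->
  (forall x y, S x -> A y -> 2 * e <= d x y) ->
  (covnum e S + covnum e A <= covnum e (S `|` A))%N.
Proof.
move=> e0 bS bA sep; have [s ss <-] := cov_witness e0 (hboundedU bS bA).
pose p y := `[< exists2 x, S x & d x y < e >].
rewrite -(count_predC p s) -!size_filter; apply: leq_add; apply: cov_le.
  move=> x Sx; have [|y ys xy] := ss x; first by left.
  by exists y => //; rewrite mem_filter ys andbT; apply/asboolP; exists x.
move=> x Ax; have [|y ys xy] := ss x; first by right.
exists y => //; rewrite mem_filter ys andbT; apply/negP => /asboolP[z Sz zy].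
have := sep z x Sz Ax; have := hdist_triangle d z y x.
rewrite (hdistC d y x); move: (d z y) (d x y) (d z x) zy xy => *; lra.
Qed.

Lemma cov_ltrans e g S : 0 < e -> hbounded S ->
  (covnum e (ltrans g S) <= covnum e S)%N.
Proof.
move=> e0 bS; have [s Ss <-] := cov_witness e0 bS.
rewrite -(size_map (fun x => g * x)%g); apply: cov_le => _ [x /Ss[y ys xy] <-].
by exists (g * y)%g; [exact: map_f|rewrite hdist_mul2l].
Qed.

Lemma cov_gt0 e S x : 0 < e -> hbounded S -> S x -> (0 < covnum e S)%N.
Proof.
move=> e0 bS Sx; have [s Ss <-] := cov_witness e0 bS.
by have [y + _] := Ss x Sx; case: (s).
Qed.

Lemma cov0 e : covnum e set0 = 0%N.
Proof. by apply/eqP; rewrite -leqn0; apply: (@cov_le e set0 [::]). Qed.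

Lemma cov_cover e S A (s : seq G) : 0 < e -> hbounded S -> hbounded A ->
  S `<=` [set x | exists2 h, h \in s & ltrans h A x] ->
  (covnum e S <= size s * covnum e A)%N.
Proof.
move=> e0 + bA; elim: s S => [|h s IH] S bS SA.
  rewrite (_ : S = set0) ?cov0//; rewrite -subset0 => x /SA[h].
  by rewrite in_nil.
pose S1 := S `&` ltrans h A; pose S2 := S `\` ltrans h A.
have bS1 : hbounded S1 by apply: hboundedS bS; exact: subIsetl.
have bS2 : hbounded S2 by apply: hboundedS bS; exact: subIsetl.
rewrite -(setUIDK S (ltrans h A)) (leq_trans (cov_subadd e0 bS1 bS2))//.
rewrite /= mulSn leq_add//.
  have bh := hbounded_ltrans h bA.
  by rewrite (leq_trans _ (cov_ltrans h e0 bA))// cov_mono//; exact: subIsetr.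
apply: IH => // x [Sx nhA]; have [g] := SA x Sx.
by rewrite inE => /orP[/eqP ->|gs] gA; [|exists g].
Qed.

Definition mesh (k : nat) : R := k.+1%:R^-1.

Lemma mesh_gt0 k : 0 < mesh k.
Proof. by rewrite invr_gt0. Qed.

Lemma truncn_le_natS (a : R) k : (Num.truncn a <= k)%N -> a <= k.+1%:R.
Proof.
by move=> ak; rewrite (le_trans (ltW (truncnS_gt _)))// ler_nat ltnS.
Qed.

Lemma mesh_le (a : R) k : 0 < a -> (Num.truncn a^-1 <= k)%N -> mesh k <= a.
Proof.
move=> a0 ak; rewrite /mesh -[leRHS]invrK lef_pV2 ?posrE ?invr_gt0//.
exact: truncn_le_natS.
Qed.

Definition covering_ratio S (k : nat) : R :=
  (covnum (mesh k) S)%:R / (covnum (mesh k) (hball d 1 1%g))%:R.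

(** Up to a factor this plays the part of Haar measure. *)
Definition vol S : R := ulim (covering_ratio S).

Lemma hball1 t : 0 < t -> hball d t 1%g 1%g.
Proof. by rewrite /hball /= hdistxx. Qed.

Lemma cov_unit_gt0 k : 0 < (covnum (mesh k) (hball d 1 1%g))%:R :> R.
Proof.
rewrite ltr0n; apply: (@cov_gt0 _ _ 1%g) => //; first exact: mesh_gt0.
  exact: hbounded_hball.
exact: hball1.
Qed.

Lemma covering_ratio_ge0 S k : 0 <= covering_ratio S k.
Proof. by rewrite /covering_ratio divr_ge0. Qed.

Lemma covering_ratio_bounded S : hbounded S -> ubounded (covering_ratio S).
Proof.
move=> bS; case: (bS) => t St; have [s hs] := hball_seq_cover d t ltr01.
exists (size s)%:R => k.
rewrite ger0_norm ?covering_ratio_ge0// /covering_ratio.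
rewrite ler_pdivrMr ?cov_unit_gt0// -natrM ler_nat.
apply: cov_cover => //; [exact: mesh_gt0|exact: hbounded_hball|].
move=> x /St /hs[y ys xy]; exists y => //; rewrite ltransE /=.
by rewrite /hball /= hdist_mulVl mulg1.
Qed.

Lemma vol_ge0 S : hbounded S -> 0 <= vol S.
Proof.
move=> bS; rewrite -(@ulim_cst R 0); apply: ulim_le.
- exact: ubounded_cst.
- exact: covering_ratio_bounded.
- by apply: nearW => k; exact: covering_ratio_ge0.
Qed.

Lemma vol_mono S A : hbounded A -> S `<=` A -> vol S <= vol A.
Proof.
move=> bA SA; have bS := hboundedS SA bA.
apply: ulim_le; [exact: covering_ratio_bounded|exact: covering_ratio_bounded|].
apply: nearW => k; rewrite /covering_ratio ler_pM2r ?invr_gt0 ?cov_unit_gt0//.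
by rewrite ler_nat cov_mono// mesh_gt0.
Qed.

Lemma vol_subadd S A : hbounded S -> hbounded A ->
  vol (S `|` A) <= vol S + vol A.
Proof.
move=> bS bA; have cS := covering_ratio_bounded bS.
have cA := covering_ratio_bounded bA.
rewrite -ulimD//; apply: ulim_le.
- exact/covering_ratio_bounded/hboundedU.
- exact: uboundedD.
apply: nearW => k; rewrite /covering_ratio /= -mulrDl.
rewrite ler_pM2r ?invr_gt0 ?cov_unit_gt0//.
by rewrite -natrD ler_nat cov_subadd// mesh_gt0.
Qed.

(** Additivity holds at every mesh below a / 2, hence in the limit. *)
Lemma vol_sep S A a : hbounded S -> hbounded A -> 0 < a ->
  (forall x y, S x -> A y -> a <= d x y) -> vol S + vol A <= vol (S `|` A).
Proof.
move=> bS bA a0 sep; have cS := covering_ratio_bounded bS.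
have cA := covering_ratio_bounded bA.
rewrite -ulimD//; apply: ulim_le.
- exact: uboundedD.
- exact/covering_ratio_bounded/hboundedU.
have a20 : 0 < a / 2 by rewrite divr_gt0.
exists (Num.truncn (a / 2)^-1) => // k /= ak.
rewrite /covering_ratio -mulrDl ler_pM2r ?invr_gt0 ?cov_unit_gt0//.
rewrite -natrD ler_nat cov_sep// ?mesh_gt0// => x y Sx Ay.
rewrite (le_trans _ (sep x y Sx Ay))//.
by have := mesh_le a20 ak; lra.
Qed.

Lemma vol_ltrans_le g S : hbounded S -> vol (ltrans g S) <= vol S.
Proof.
move=> bS; apply: ulim_le.
- exact/covering_ratio_bounded/hbounded_ltrans.
- exact: covering_ratio_bounded.
apply: nearW => k; rewrite /covering_ratio ler_pM2r ?invr_gt0 ?cov_unit_gt0//.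
by rewrite ler_nat cov_ltrans// mesh_gt0.
Qed.

Lemma vol_ltrans g S : hbounded S -> vol (ltrans g S) = vol S.
Proof.
move=> bS; apply/eqP; rewrite eq_le vol_ltrans_le//=.
rewrite -[X in vol X <= _](ltransK g); apply: vol_ltrans_le.
exact: hbounded_ltrans.
Qed.

Lemma vol_unit : vol (hball d 1 1%g) = 1.
Proof.
rewrite /vol (_ : covering_ratio _ = fun=> 1) ?ulim_cst//.
by apply/funext => k; rewrite /covering_ratio divff// gt_eqF// cov_unit_gt0.
Qed.

Lemma vol_cover S A (s : seq G) : hbounded S -> hbounded A ->
  S `<=` [set x | exists2 h, h \in s & ltrans h A x] ->
  vol S <= (size s)%:R * vol A.
Proof.
move=> bS bA; elim: s S bS => [|h s IH] S bS SA.
  rewrite mul0r (_ : S = set0).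
    rewrite /vol (_ : covering_ratio _ = fun=> 0) ?ulim_cst//.
    by apply/funext => k; rewrite /covering_ratio cov0 mul0r.
  by rewrite -subset0 => x /SA[h]; rewrite in_nil.
pose S2 := S `\` ltrans h A.
have bS2 : hbounded S2 by apply: hboundedS bS; exact: subIsetl.
have bh := hbounded_ltrans h bA.
apply: (@le_trans _ _ (vol (ltrans h A `|` S2))).
  apply: vol_mono; first exact: hboundedU.
  by move=> x Sx; have [hx|nhx] := pselect (ltrans h A x); [left|right].
rewrite (le_trans (vol_subadd bh bS2))//.
rewrite -[size _]/(size s).+1 -natr1 mulrDl mul1r addrC.
rewrite lerD//; last by rewrite vol_ltrans.
apply: IH => // x [Sx nhA]; have [g] := SA x Sx.
by rewrite inE => /orP[/eqP ->|gs] gA; [|exists g].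
Qed.

Lemma vol_hball_ge1 t : 1 <= t -> 1 <= vol (hball d t 1%g).
Proof.
move=> t1; rewrite -vol_unit; apply: vol_mono; first exact: hbounded_hball.
by move=> x; rewrite /hball /= => /lt_le_trans; apply.
Qed.

Lemma vol_doubling : exists N : nat, forall t, 0 < t ->
  vol (hball d (2 * t) 1%g) <= N%:R * vol (hball d t 1%g).
Proof.
have [N hN] := hball_cover d (ltr0Sn R 1) ltr01; exists N => t t0.
have [s sN] := hN t t0; rewrite mul1r => sc.
apply: (@le_trans _ _ ((size s)%:R * vol (hball d t 1%g))).
  apply: vol_cover; [exact: hbounded_hball|exact: hbounded_hball|].
  move=> x /sc[y ys xy]; exists y => //; rewrite ltransE /=.
  by rewrite /hball /= hdist_mulVl mulg1.
by rewrite ler_wpM2r ?ler_nat// vol_ge0//; exact: hbounded_hball.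
Qed.

Definition annulus t r := hball d (t + r) 1%g `\` hball d t 1%g.

Lemma hbounded_annulus t r : hbounded (annulus t r).
Proof. by apply: hboundedS (hbounded_hball (t + r)); exact: subIsetl. Qed.

(** Otherwise every annulus of width r and inner radius at least 1 carries a
    proportion e of the ball inside it. Stacking i such annuli, with gaps of
    width 1 that make them separated, between the radii T and 2 T = T + i (r +
    1) would give the ball of radius 2 T at least (1 + i e) times the content
    of the ball of radius T, against doubling when i e exceeds the doubling
    constant. *)
Lemma folner_radius r e : 0 < r -> 0 < e -> exists2 t, 1 <= t &
  vol (annulus t r) <= e * vol (hball d t 1%g).
Proof.
move=> r0 e0; apply: contrapT => H.
have {}H t : 1 <= t -> e * vol (hball d t 1%g) <= vol (annulus t r).
  by move=> t1; rewrite leNgt; apply/negP => /ltW lt; apply: H; exists t.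
have [N doub] := vol_doubling.
pose i := (Num.truncn (N%:R / e)).+1.
have iN : N%:R < i%:R * e by rewrite -ltr_pdivrMr// truncnS_gt.
pose T := i%:R * (r + 1).
have i1 : 1 <= i%:R :> R by rewrite ler1n.
have T1 : 1 <= T by rewrite /T; nra.
have step j : (1 + j%:R * e) * vol (hball d T 1%g) <=
    vol (hball d (T + j%:R * (r + 1)) 1%g).
  elim: j => [|j IH]; first by rewrite !mul0r !addr0 mul1r.
  set t := T + j%:R * (r + 1) in IH.
  have j0 := ler0n R j.
  have tT : T <= t by rewrite /t lerDl mulr_ge0// addr_ge0// ltW.
  have t1 : 1 <= t + 1 by lra.
  have mono : vol (hball d T 1%g) <= vol (hball d (t + 1) 1%g).
    apply: vol_mono; first exact: hbounded_hball.
    by move=> x; rewrite /hball /= => xT; lra.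
  have -> : T + j.+1%:R * (r + 1) = t + 1 + r by rewrite -natr1 /t; ring.
  have sub : hball d t 1%g `|` annulus (t + 1) r `<=` hball d (t + 1 + r) 1%g.
    by move=> x [|[]]; rewrite /hball /=//; lra.
  have sep : vol (hball d t 1%g) + vol (annulus (t + 1) r) <=
      vol (hball d t 1%g `|` annulus (t + 1) r).
    apply: (@vol_sep _ _ 1) => //.
    - exact: hbounded_hball.
    - exact: hbounded_annulus.
    move=> x y; rewrite /hball /annulus /hball /= => xt [_ /negP].
    rewrite -leNgt => yt.
    have := hdist_triangle d y x 1%g; rewrite (hdistC d y x).
    by move: xt yt; move: (d x 1%g) (d y 1%g) (d x y) => a b c *; lra.
  have le1 := vol_mono (hbounded_hball (t + 1 + r)) sub.
  have le2 := H (t + 1) t1.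
  have le3 : e * vol (hball d T 1%g) <= e * vol (hball d (t + 1) 1%g).
    by rewrite ler_pM2l.
  by rewrite -natr1; move: IH le1 le2 le3 sep; set a := vol _; set b := vol _;
    nra.
have T0 : 0 < T by lra.
have := step i; have := doub T T0.
have -> : 2 * T = T + i%:R * (r + 1) by rewrite /T; ring.
have := vol_hball_ge1 T1.
set a := vol (hball d T 1%g); set b := vol _ => *; nra.
Qed.

(** The annulus beyond the j-th radius has width j + 1, so that it eventually
    absorbs the displacement by any fixed element. *)
Definition folner_seq (j : nat) : R :=
  projT1 (cid2 (folner_radius (ltr0Sn R j) (mesh_gt0 j))).

Lemma folner_seq_ge1 j : 1 <= folner_seq j.
Proof. by rewrite /folner_seq; case: cid2. Qed.

Lemma folner_seqP j : vol (annulus (folner_seq j) j.+1%:R) <=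
  mesh j * vol (hball d (folner_seq j) 1%g).
Proof. by rewrite /folner_seq; case: cid2. Qed.

Let folner_ball j := hball d (folner_seq j) 1%g.

Lemma vol_folner_ball_gt0 j : 0 < vol (folner_ball j).
Proof. by rewrite (lt_le_trans ltr01)// vol_hball_ge1// folner_seq_ge1. Qed.

Lemma hbounded_folner_ballI S j : hbounded (S `&` folner_ball j).
Proof.
by apply: hboundedS (hbounded_hball (folner_seq j)); exact: subIsetr.
Qed.

Definition folner_density S (j : nat) : R :=
  vol (S `&` folner_ball j) / vol (folner_ball j).

Definition folner_mean S : R := ulim (folner_density S).

Lemma folner_density_bounded S : ubounded (folner_density S).
Proof.
exists 1 => j; rewrite ger0_norm; last first.
  rewrite divr_ge0 ?vol_ge0//; first exact: hbounded_folner_ballI.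
  exact: hbounded_hball.
rewrite ler_pdivrMr ?vol_folner_ball_gt0// mul1r; apply: vol_mono.
  exact: hbounded_hball.
exact: subIsetr.
Qed.

Lemma folner_mean_mono S A : S `<=` A -> folner_mean S <= folner_mean A.
Proof.
move=> SA; apply: ulim_le; try exact: folner_density_bounded.
apply: nearW => j; rewrite ler_pM2r ?invr_gt0 ?vol_folner_ball_gt0//.
by apply: vol_mono; [exact: hbounded_folner_ballI|exact: setSI].
Qed.

Lemma folner_mean_subadd S A :
  folner_mean (S `|` A) <= folner_mean S + folner_mean A.
Proof.
have bS := folner_density_bounded S; have bA := folner_density_bounded A.
rewrite -ulimD//; apply: ulim_le.
- exact: folner_density_bounded.
- exact: uboundedD.
apply: nearW => j; rewrite /= -mulrDl ler_pM2r ?invr_gt0 ?vol_folner_ball_gt0//.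
by rewrite setIUl; apply: vol_subadd; exact: hbounded_folner_ballI.
Qed.

(** The gap between the two sets may shrink as the balls grow: the mesh tends
    to 0 before the radius tends to infinity. *)
Lemma folner_mean_sep S A : (forall t, exists2 a, 0 < a & forall x y,
    (S `&` hball d t 1%g) x -> (A `&` hball d t 1%g) y -> a <= d x y) ->
  folner_mean S + folner_mean A <= folner_mean (S `|` A).
Proof.
move=> sep; have bS := folner_density_bounded S.
have bA := folner_density_bounded A.
rewrite -ulimD//; apply: ulim_le.
- exact: uboundedD.
- exact: folner_density_bounded.
apply: nearW => j; rewrite /= -mulrDl ler_pM2r ?invr_gt0 ?vol_folner_ball_gt0//.
have [a a0 sepa] := sep (folner_seq j).
by rewrite setIUl; apply: vol_sep a0 sepa; exact: hbounded_folner_ballI.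
Qed.

Lemma folner_meanT : folner_mean setT = 1.
Proof.
rewrite /folner_mean (_ : folner_density _ = fun=> 1) ?ulim_cst//.
apply/funext => j; rewrite /folner_density setTI divff//.
by rewrite gt_eqF// vol_folner_ball_gt0.
Qed.

(** Translating by h moves a ball out of itself by at most the norm of h, hence
    into an annulus of negligible relative content. *)
Lemma folner_mean_ltrans_le h S : folner_mean (ltrans h S) <= folner_mean S.
Proof.
apply/ler_addgt0Pr => e e0; rewrite -(ulim_cst e).
have bS := folner_density_bounded S; have be := ubounded_cst e.
rewrite -ulimD//; apply: ulim_le.
- exact: folner_density_bounded.
- exact: uboundedD.
exists (maxn (Num.truncn (d h 1%g)) (Num.truncn e^-1)) => // j /=.
rewrite geq_max => /andP[hj ej].
have hj1 : d h 1%g <= j.+1%:R by exact: truncn_le_natS.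
have ej1 : mesh j <= e by exact: mesh_le.
rewrite /folner_density ler_pdivrMr ?vol_folner_ball_gt0// mulrDl.
rewrite divfK ?gt_eqF ?vol_folner_ball_gt0//.
have bI := hbounded_folner_ballI.
rewrite -(vol_ltrans h^-1%g (bI _ j)).
have sub : ltrans h^-1%g (ltrans h S `&` folner_ball j) `<=`
    (S `&` folner_ball j) `|` annulus (folner_seq j) j.+1%:R.
  move=> _ [_ [[x Sx <-] hx] <-]; rewrite mulKg.
  have [xj|xj] := pselect (folner_ball j x); first by left.
  right; split => //; rewrite /hball /=.
  have := hdist_triangle d x h^-1%g 1%g; rewrite hdist_inv.
  rewrite -(hdist_mul2l d h x h^-1%g) mulgV => le.
  by rewrite (le_lt_trans le)// ltr_leD.
have bU := hboundedU (bI S j) (hbounded_annulus (folner_seq j) j.+1%:R).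
rewrite (le_trans (vol_mono bU sub))//.
rewrite (le_trans (vol_subadd (bI S j) (hbounded_annulus _ _)))// lerD2l.
rewrite (le_trans (folner_seqP j))// ler_pM2r ?vol_folner_ball_gt0//.
Qed.

Lemma folner_mean_ltrans h S : folner_mean (ltrans h S) = folner_mean S.
Proof.
apply/eqP; rewrite eq_le folner_mean_ltrans_le.
rewrite -[X in folner_mean X <= _](ltransK h).
exact: folner_mean_ltrans_le.
Qed.

Lemma compact_closed_gap (K F : set G) :
  compact K -> closed F -> K `&` F = set0 ->
  exists2 a, 0 < a & forall x y, K x -> F y -> a <= d x y.
Proof.
move=> /compact_near_coveringP cK cF KF.
pose P (k : nat) x := forall y, F y -> mesh k <= d x y.
suff [k _ /(_ k (leqnn k)) Pk] : \forall k \near \oo, K `<=` P k.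
  by exists (mesh k); [exact: mesh_gt0|move=> x y /Pk; exact].
apply: (cK _ \oo P) => x Kx.
have /(hdist_nbhs d)[e e0 eF] : nbhs x (~` F).
  apply: open_nbhs_nbhs; split; first exact: closed_openC.
  by move=> Fx; have : (K `&` F) x by []; rewrite KF.
have e20 : 0 < e / 2 by rewrite divr_gt0.
exists (hball d (e / 2) x, [set k | (Num.truncn (e / 2)^-1 <= k)%N]) => /=.
  by split; [exact: nbhs_hball|exists (Num.truncn (e / 2)^-1)].
move=> [z k] /= [zx ek] y Fy.
have h := mesh_le e20 ek.
have : e <= d y x by rewrite leNgt; apply/negP => /eF; exact.
have := hdist_triangle d y z x; rewrite (hdistC d y z).
by move: zx; rewrite /hball /=; move: (d z x) (d z y) (d y x) => *; lra.
Qed.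

End CoveringNumber.

(** * The hull *)
Section SubtypeTopology.
Context {X : topologicalType} (A : set X).

Lemma set_type_openP (U : set (set_type A)) : open U <->
  exists2 V : set X, open V & \val @^-1` V = U.
Proof. by split=> -[V oV <-]; exists V. Qed.

Lemma val_continuous : continuous (\val : set_type A -> X).
Proof. exact: initial_continuous. Qed.

Lemma set_type_nbhsP (x : set_type A) (U : set (set_type A)) : nbhs x U <->
  exists2 V, nbhs (\val x) V & \val @^-1` V `<=` U.
Proof.
split=> [xU|[V nV VU]]; last by apply: filterS VU _; exact: val_continuous.
rewrite nbhsE in xU; have [W [/set_type_openP[V oV <-] Wx] WU] := xU.
by exists V => //; exact: (open_nbhs_nbhs (conj oV Wx)).
Qed.

Lemma set_type_hausdorff : hausdorff_space X -> hausdorff_space (set_type A).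
Proof.
move=> hX x y xy; apply/val_inj/hX => U V nU nV.
have [z [Uz Vz]] := xy _ _ (val_continuous nU) (val_continuous nV).
by exists (\val z).
Qed.

Lemma set_type_compact : compact A -> compact [set: set_type A].
Proof.
move=> cA F FF _; have FvA : (\val @ F) A.
  by apply: (@nearW _ F) => x; exact: set_valP.
have [p [Ap clp]] := cA (\val @ F) _ FvA.
exists (exist _ p (mem_set Ap)); split => // U V FU /set_type_nbhsP[W nW WV].
have FvU : (\val @ F) (\val @` U).
  by apply: (@filterS _ F _ U) => // x Ux; exists x.
have [_ [[x Ux <-] Wx]] := clp _ _ FvU nW.
by exists x; split => //; exact: WV.
Qed.

Lemma set_type_second_countable : @second_countable X ->
  @second_countable (set_type A).
Proof.
move=> [B cB [Bo Bn]]; exists ((fun V => \val @^-1` V) @` B).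
  exact: sub_countable (card_image_le _ _) cB.
split; first by move=> _ [V /Bo oV <-]; apply/set_type_openP; exists V.
move=> x U /set_type_nbhsP[V /Bn[W [BW Wx] WV] VU].
exists (\val @^-1` W); first by split => //; exists W.
by move=> y /WV /VU.
Qed.

End SubtypeTopology.

Section Hull.
Context (R : realType) (n : nat) (G : lieGroupType R n)
  (D : homogeneousStructure G) (d : homogeneousMetric D) (C : closedSet G).
Local Notation H := (hullType C).

Lemma closedSet_hausdorff : hausdorff_space (closedSet G).
Proof. exact: fell_hausdorff (G_compact_nbhs_basis d). Qed.

Lemma hull_hausdorff : hausdorff_space H.
Proof. exact/set_type_hausdorff/closedSet_hausdorff. Qed.

Lemma hull_compact : compact [set: H].
Proof.
apply: set_type_compact; apply: (subclosed_compact _ (@fell_compact G)) => //.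
exact: closed_closure.
Qed.

Lemma hull_open_Fsigma (U : set H) : open U -> Fsigma U.
Proof.
apply: compact_hausdorff_open_Fsigma.
- exact: hull_hausdorff.
- exact: hull_compact.
apply: set_type_second_countable; apply: fell_second_countable.
- exact: G_compact_nbhs_basis d.
- exact: lie_hausdorff.
- exact: lie_second_countable.
Qed.

Lemma hull_act_continuous (g : G) : continuous (@hull_act G C g).
Proof.
move=> x U /set_type_nbhsP[V nV VU]; apply/set_type_nbhsP.
exists (translate g @^-1` V); first exact: translate_continuous.
by move=> y Vy; exact: VU.
Qed.

Lemma hull_actK (g : G) : cancel (@hull_act G C g) (@hull_act G C g^-1%g).
Proof. by move=> x; apply/val_inj/closedSet_inj; rewrite /= ltransK. Qed.

Lemma hull_actVK (g : G) : cancel (@hull_act G C g^-1%g) (@hull_act G C g).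
Proof. by move=> x; have := hull_actK g^-1%g x; rewrite invgK. Qed.

Definition hull_base : H := exist _ C (mem_set (@hull_self G C)).

Lemma hull_orbit_continuous : continuous (fun g : G => hull_act g hull_base).
Proof.
move=> g U /set_type_nbhsP[V nV VU].
have nVg := orbit_continuous (G_compact_nbhs_basis d) nV.
by apply: (@filterS _ (nbhs g) _ _ _ _ nVg) => h Vh; exact: VU.
Qed.

Definition hull_mean (K : set H) : R :=
  folner_mean d [set g | K (hull_act g hull_base)].

Lemma hull_mean_act (h : G) K : hull_mean (hull_act h @^-1` K) = hull_mean K.
Proof.
have actM g :
    hull_act h (hull_act (h^-1 * g)%g hull_base) = hull_act g hull_base.
  by apply/val_inj/closedSet_inj; rewrite /= -ltransM mulVKg.
rewrite /hull_mean -[LHS](folner_mean_ltrans d h) ltransE; congr folner_mean.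
by apply/seteqP; split => g /=; rewrite actM.
Qed.

(** Within a ball, the return times to two disjoint closed sets lie in disjoint
    compact sets, which are at positive distance. *)
Lemma hull_mean_add K F : closed K -> closed F -> K `&` F = set0 ->
  hull_mean K + hull_mean F <= hull_mean (K `|` F).
Proof.
move=> cK cF KF; apply: folner_mean_sep => t.
have cl (E : set H) : closed E -> closed [set g : G | E (hull_act g hull_base)].
  by move=> cE; apply: preimage_closed cE => g _; exact: hull_orbit_continuous.
have cKt : compact ([set g : G | K (hull_act g hull_base)] `&` cball d t 1%g).
  by rewrite setIC; apply: compact_closedI; [exact: compact_cball|exact: cl].
have [|a a0 gap] := compact_closed_gap d cKt (cl F cF).
  rewrite -subset0 => g [[Kg _] Fg].
  by have : (K `&` F) (hull_act g hull_base) by []; rewrite KF.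
exists a => // x y [Kx xt] [Fy _]; apply: gap => //; split => //.
exact: hball_cball.
Qed.

Lemma hull_invariant_exists : exists mu : probability (hullBorel C) R,
  act_invariant (@hull_act G C) mu.
Proof.
apply: (@exists_invariant_measure R H hull_hausdorff hull_compact hull_mean
  _ _ _ _ G (@hull_act G C) (fun g => @hull_act G C g^-1%g)).
- by move=> F K _ _ FK; apply: folner_mean_mono => g; exact: FK.
- by move=> F K _ _; apply: folner_mean_subadd.
- exact: hull_mean_add.
- exact: folner_meanT.
- exact: hull_act_continuous.
- by move=> g; exact: hull_act_continuous.
- exact: hull_actK.
- exact: hull_actVK.
- by move=> g K _; exact: hull_mean_act.
Qed.

Hypothesis C_rep : linearly_repetitive d C.

(** Closed and open subsets of the hull are traces of closed and open sets of
    closed subsets of G, to which [pattern_counting] applies. *)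
Lemma hull_count_dominated : exists2 delta : R, 0 < delta < 1 &
  count_dominated (fun g => @hull_act G C g^-1%g) delta.
Proof.
have [delta delta01 dom] := pattern_counting C_rep.
exists delta => // K U cK oU KU.
have [U0 oU0 U0E] := (set_type_openP U).1 oU.
have [V0 oV0 V0E] := (set_type_openP (~` K)).1 (closed_openC cK).
pose K0 := hull C `\` V0.
have cK0 : closed K0.
  by apply: closedI; [exact: closed_closure|exact: open_closedC].
have K0E (x : H) : K x <-> K0 (\val x).
  have : V0 (\val x) <-> ~ K x by rewrite -[~ K x]/((~` K) x) -V0E.
  move=> h; split=> [Kx|[_ nV]].
    by split; [exact: set_valP|move=> /h].
  by apply: contrapT => /h.
have KU0 : K0 `<=` U0.
  move=> x K0x; pose y : H := exist _ x (mem_set K0x.1).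
  have /KU : K y by apply/K0E.
  by rewrite -U0E.
have [s [t [_ t0 st le]]] := dom K0 U0 cK0 oU0 KU0.
exists s, t; split => // x y.
have := le _ _ (set_valP x) (set_valP y); rewrite /visits.
have -> : count (fun g => `[< K0 (translate g^-1%g (\val x)) >]) s =
    count (fun g => `[< K (hull_act g^-1%g x) >]) s.
  by apply: eq_count => g; apply/asboolP/asboolP => ?;
    exact/(K0E (hull_act g^-1%g x)).
have -> // : count (fun g => `[< U0 (translate g^-1%g (\val y)) >]) t =
    count (fun g => `[< U (hull_act g^-1%g y) >]) t.
by apply: eq_count => g; rewrite -U0E.
Qed.

(** With K a point y of the hull, y itself visits K at the identity, so every x
    visits each neighbourhood of y. *)
Lemma hull_minimal : minimal C.
Proof.
move=> x O [y Oy] oO.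
have [U0 oU0 U0E] := (set_type_openP O).1 oO.
have [delta _ dom] := pattern_counting C_rep.
have cy : closed [set \val y].
  apply: compact_closed; first exact: closedSet_hausdorff.
  exact: compact_set1.
have yU0 : [set \val y] `<=` U0 by move=> _ ->; rewrite -U0E in Oy.
have [s [t [s1 _ _ le]]] := dom _ U0 cy oU0 yU0.
have : (0 < visits U0 (\val x) t)%N.
  apply: leq_trans (le _ _ (set_valP y) (set_valP x)).
  rewrite -has_count; apply/hasP; exists 1%g => //.
  by apply/asboolP; rewrite invg1 translate1.
rewrite -has_count => /hasP[v _ /asboolP Uv].
exists (hull_act v^-1%g x); split; last by exists v^-1%g.
by rewrite -U0E.
Qed.

Lemma hull_uniquely_ergodic : uniquely_ergodic R C.
Proof.
have [mu imu] := hull_invariant_exists.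
exists mu; split => // nu inu E mE.
have [delta /andP[d0 d1] dom] := hull_count_dominated.
apply: (invariant_unique (act := fun g => @hull_act G C g^-1%g)
  _ _ d0 d1 dom) => //.
- by move=> g; exact: hull_act_continuous.
- exact: hull_open_Fsigma.
- by move=> g F mF; exact: imu.
- by move=> g F mF; exact: inu.
Qed.

End Hull.

Theorem theorem1p1 (R : realType) (n : nat) (G : lieGroupType R n)
    (Gconn : connected [set: G]) (Gsc : simply_connected R G)
    (D : homogeneousStructure G) (d : homogeneousMetric D)
    (L : deloneSet d) (Lrep : linearly_repetitive d L) :
  minimal (delone_closedSet L) /\ uniquely_ergodic R (delone_closedSet L).
Proof.
split.
  exact: (@hull_minimal R n G D d (delone_closedSet L) Lrep).
exact: (@hull_uniquely_ergodic R n G D d (delone_closedSet L) Lrep).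
Qed.
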